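(* Let $\Gamma$ be a Fuchsian group without elliptic elements such that the quotient surface $S := \Gamma\backslash\mathbb{H}^2$ is geometrically infinite. Let $u \in T^1S$ belong to the non-wandering set $\Omega_h$ of the horocycle flow $h_{\mathbb{R}}$ on $T^1S$. Suppose that $u(\mathbb{R}^+)$ is almost minimizing and that the orbit $h_{\mathbb{R}}u$ is not periodic, and define $$\underline{\mathrm{Inj}}(u(\mathbb{R}^+)) := \liminf_{t\to+\infty} \mathrm{Inj}(u(t)).$$ If $\underline{\mathrm{Inj}}(u(\mathbb{R}^+)) < +\infty$, then there exists a sequence of times $t_n$ converging to $+\infty$ such that $g_{t_n}u \in \overline{h_{\mathbb{R}}u}$ for all $n$. Moreover, if $\underline{\mathrm{Inj}}(u(\mathbb{R}^+)) = 0$, then $g_{\mathbb{R}^+}u \subset \overline{h_{\mathbb{R}}u}$.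
   Context: A Fuchsian group is a discrete subgroup $\Gamma$ of $\mathrm{PSL}_2(\mathbb{R})$, acting by orientation-preserving isometries on the hyperbolic plane $\mathbb{H}^2$ (upper half-plane model) and on its unit tangent bundle $T^1\mathbb{H}^2$. Set $T^1S := \Gamma\backslash(T^1\mathbb{H}^2)$. The surface $S$ is geometrically finite if its fundamental group is finitely generated, and geometrically infinite otherwise. $g_{\mathbb{R}}$ denotes the geodesic flow and $h_{\mathbb{R}}$ the horocycle flow, on $T^1\mathbb{H}^2$ and, by descent, on $T^1S$. For $\tilde u\in T^1\mathbb{H}^2$, $\tilde u^+\in\partial\mathbb{H}^2=\mathbb{R}\cup\{\infty\}$ is the endpoint of the half-geodesic $\{g_t\tilde u\}_{t\ge 0}$; the orbit $h_{\mathbb{R}}\tilde u$ consists of the unit vectors based on the horocycle centered at $\tilde u^+$ through the base point of $\tilde u$, and pointing towards $\tilde u^+$ (unit-speed parametrization of the horocycle). For $u\in T^1S$, $u(t)\in S$ denotes the base point of $g_tu$, and $u(\mathbb{R}^+)=\{u(t): t\ge 0\}$ is the corresponding half-geodesic; $g_{\mathbb{R}^+}u=\{g_tu : t\geq 0\}$ and $h_{\mathbb{R}}u=\{h_su : s\in\mathbb{R}\}$. Closures are taken in $T^1S$. The non-wandering set $\Omega_h$ is the set of $u\in T^1S$ such that for every neighborhood $V$ of $u$ there is a sequence $s_n\to+\infty$ with $h_{s_n}V\cap V\neq\emptyset$. The half-geodesic $u(\mathbb{R}^+)$ is almost minimizing if there exists $C>0$ such that $d(u(0),u(t)) > t-C$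 for all $t>0$, where $d$ is the distance on $S$. For $p\in S$, the injectivity radius is $\mathrm{Inj}(p) := \min_{\gamma\in\Gamma,\ \gamma\neq \mathrm{id}} d(\tilde p,\gamma\tilde p)$, where $\tilde p$ is any lift of $p$ to $\mathbb{H}^2$. *)

(* Defs.v *)
From HB Require Import structures.
From mathcomp Require Import all_boot all_order all_algebra generic_quotient.
From mathcomp Require Import complex ring lra.
From mathcomp Require Import all_classical reals ereal topology normedtype sequences exp.

Set Implicit Arguments.
Unset Strict Implicit.
Unset Printing Implicit Defensive.

Import Order.TTheory GRing.Theory Num.Theory.
Import numFieldNormedType.Exports.

Local Open Scope classical_set_scope.
Local Open Scope ring_scope.
Local Open Scope complex_scope.
Local Open Scope quotient_scope.

Section SpecialLinear.
Variable R : realType.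

Definition mx2 (a b c d : R) : 'M[R]_2 :=
  \matrix_(i, j) if i == 0 then (if j == 0 then a else b)
                 else (if j == 0 then c else d).

Lemma det_2x2 (A : 'M[R]_2) : \det A = A 0 0 * A 1 1 - A 0 1 * A 1 0.
Proof.
rewrite (expand_det_row _ ord0) !big_ord_recl big_ord0 addr0 /cofactor.
rewrite !det_mx11 !mxE /= expr0 mul1r /bump /= expr1.
have -> : lift ord0 ord0 = 1 :> 'I_2 by exact/val_inj.
have -> : lift 1 0 = 0 :> 'I_2 by exact/val_inj.
have -> : ord0 = 0 :> 'I_2 by exact/val_inj.
by ring.
Qed.

Definition SL2 : Type := set_type [set A : 'M[R]_2 | \det A = 1].
HB.instance Definition _ := Topological.on SL2.
HB.instance Definition _ := SubChoice.on SL2.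

Lemma SL2_det (A : SL2) : \det (val A) = 1.
Proof. by case: A => A /= /set_mem. Qed.

Definition mkSL2 (A : 'M[R]_2) (hA : \det A = 1) : SL2 :=
  exist _ A (mem_set hA).

Lemma SL2_mul_subproof (A B : SL2) : \det (val A *m val B) = 1.
Proof. by rewrite det_mulmx !SL2_det mulr1. Qed.

Lemma SL2_inv_subproof (A : SL2) : \det (invmx (val A)) = 1.
Proof. by rewrite det_inv SL2_det invr1. Qed.

Definition SL2_one : SL2 := mkSL2 (det1 _ _).
Definition SL2_mul (A B : SL2) : SL2 := mkSL2 (SL2_mul_subproof A B).
Definition SL2_inv (A : SL2) : SL2 := mkSL2 (SL2_inv_subproof A).

Lemma SL2_unit (A : SL2) : val A \in unitmx.
Proof. by rewrite unitmxE SL2_det unitr1. Qed.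

Lemma SL2_mulA : associative SL2_mul.
Proof. by move=> A B C; apply: val_inj; rewrite /= mulmxA. Qed.
Lemma SL2_mul1 : left_id SL2_one SL2_mul.
Proof. by move=> A; apply: val_inj; rewrite /= mul1mx. Qed.
Lemma SL2_1mul : right_id SL2_one SL2_mul.
Proof. by move=> A; apply: val_inj; rewrite /= mulmx1. Qed.
Lemma SL2_mulV : left_inverse SL2_one SL2_inv SL2_mul.
Proof. by move=> A; apply: val_inj; rewrite /= mulVmx ?SL2_unit. Qed.
Lemma SL2_Vmul : right_inverse SL2_one SL2_inv SL2_mul.
Proof. by move=> A; apply: val_inj; rewrite /= mulmxV ?SL2_unit. Qed.

HB.instance Definition _ := isGroup.Build SL2
  SL2_mulA SL2_mul1 SL2_1mul SL2_mulV SL2_Vmul.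

End SpecialLinear.

Section ProjectiveSpecialLinear.
Variable R : realType.

Definition sign_rel (A B : SL2 R) :=
  (val A == val B) || (val A == - val B).

Lemma sign_rel_equiv : equiv_class_of sign_rel.
Proof.
split=> [A|A B|B A C]; rewrite /sign_rel.
- by rewrite eqxx.
- by rewrite -eqr_oppLR [- val A == _]eq_sym [val B == val A]eq_sym.
- move=> /orP[]/eqP -> // /orP[]/eqP ->; rewrite ?opprK eqxx ?orbT //.
Qed.

Canonical sign_equiv := EquivRelPack sign_rel_equiv.

Definition PSL2 : Type := quotient_topology {eq_quot sign_equiv}.
HB.instance Definition _ := Topological.on PSL2.
HB.instance Definition _ := Quotient.on PSL2.

Lemma PSL2_eqP (A B : SL2 R) :
  reflect (\pi_PSL2 A = \pi_PSL2 B) (sign_rel A B).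
Proof. exact: (@eqquotP _ _ {eq_quot sign_equiv} A B). Qed.

Lemma PSL2_repr_pi (A : SL2 R) :
  val (repr (\pi_PSL2 A)) = val A \/ val (repr (\pi_PSL2 A)) = - val A.
Proof.
have /PSL2_eqP : \pi_PSL2 (repr (\pi_PSL2 A)) = \pi_PSL2 A by rewrite reprK.
by move=> /orP[]/eqP; [left|right].
Qed.

Lemma PSL2_ind (P : PSL2 -> Prop) : (forall A, P (\pi_PSL2 A)) -> forall g, P g.
Proof. by move=> h g; rewrite -[g]reprK. Qed.

Local Open Scope group_scope.

(* The operations on SL2 / {1, -1} are computed on representatives; see
   PSL2_mul_pi and PSL2_inv_pi for the independence of the choice. *)
Definition PSL2_one : PSL2 := \pi_PSL2 1.
Definition PSL2_mul (g h : PSL2) : PSL2 := \pi_PSL2 (repr g * repr h).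
Definition PSL2_inv (g : PSL2) : PSL2 := \pi_PSL2 (repr g)^-1.

Lemma PSL2_mul_pi (A B : SL2 R) : PSL2_mul (\pi_PSL2 A) (\pi_PSL2 B) = \pi_PSL2 (A * B).
Proof.
apply/PSL2_eqP; rewrite /sign_rel /=.
by have [->|->] := PSL2_repr_pi A; have [->|->] := PSL2_repr_pi B;
  rewrite ?mulmxN ?mulNmx ?opprK eqxx ?orbT.
Qed.

Lemma PSL2_inv_pi (A : SL2 R) : PSL2_inv (\pi_PSL2 A) = \pi_PSL2 A^-1.
Proof.
apply/PSL2_eqP; rewrite /sign_rel /=.
have invmxN (B : 'M[R]_2) : invmx (- B) = (- invmx B)%R := invrN B.
by have [->|->] := PSL2_repr_pi A; rewrite ?invmxN eqxx ?orbT.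
Qed.

Lemma PSL2_mulA : associative PSL2_mul.
Proof.
elim/PSL2_ind => A; elim/PSL2_ind => B; elim/PSL2_ind => C.
by rewrite !PSL2_mul_pi mulgA.
Qed.
Lemma PSL2_mul1 : left_id PSL2_one PSL2_mul.
Proof. by elim/PSL2_ind => A; rewrite PSL2_mul_pi mul1g. Qed.
Lemma PSL2_1mul : right_id PSL2_one PSL2_mul.
Proof. by elim/PSL2_ind => A; rewrite PSL2_mul_pi mulg1. Qed.
Lemma PSL2_mulV : left_inverse PSL2_one PSL2_inv PSL2_mul.
Proof. by elim/PSL2_ind => A; rewrite PSL2_inv_pi PSL2_mul_pi mulVg. Qed.
Lemma PSL2_Vmul : right_inverse PSL2_one PSL2_inv PSL2_mul.
Proof. by elim/PSL2_ind => A; rewrite PSL2_inv_pi PSL2_mul_pi mulgV. Qed.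

HB.instance Definition _ := isGroup.Build PSL2
  PSL2_mulA PSL2_mul1 PSL2_1mul PSL2_mulV PSL2_Vmul.

End ProjectiveSpecialLinear.

Section HyperbolicPlane.
Variable R : realType.

Definition cplx (z : R * R) : R[i] := z.1 +i* z.2.
Definition uncplx (w : R[i]) : R * R := (complex.Re w, complex.Im w).
Definition nsq (w : R[i]) : R := complex.Re w ^+ 2 + complex.Im w ^+ 2.

Lemma cplxK : cancel cplx uncplx. Proof. by case. Qed.
Lemma uncplxK : cancel uncplx cplx. Proof. by case. Qed.

Lemma nsqM (v w : R[i]) : nsq (v * w) = nsq v * nsq w.
Proof. by case: v => a b; case: w => c d; rewrite /nsq /=; ring. Qed.

Lemma nsq_gt0 (w : R[i]) : w != 0 -> 0 < nsq w.
Proof.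
case: w => a b; rewrite eq_complex /nsq /= => h.
rewrite lt_def addr_ge0 ?sqr_ge0 // andbT paddr_eq0 ?sqr_ge0 //.
by rewrite !sqrf_eq0.
Qed.

Lemma nsqV (w : R[i]) : nsq w^-1 = (nsq w)^-1.
Proof.
have [->|w0] := eqVneq w 0; first by rewrite invr0 /nsq /= !expr0n addr0 invr0.
have n0 : nsq w != 0 by rewrite gt_eqF // nsq_gt0.
apply: (mulfI n0); rewrite -nsqM !divff // /nsq /=.
by rewrite expr1n expr0n addr0.
Qed.

Definition mob_den (A : 'M[R]_2) (z : R[i]) : R[i] :=
  (A 1 0)%:C * z + (A 1 1)%:C.
Definition mobius (A : 'M[R]_2) (z : R[i]) : R[i] :=
  ((A 0 0)%:C * z + (A 0 1)%:C) / mob_den A z.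
Definition mobius_deriv (A : 'M[R]_2) (z : R[i]) : R[i] :=
  ((\det A)%:C) / mob_den A z ^+ 2.

Lemma mob_den_neq0 (A : 'M[R]_2) (z : R[i]) :
  \det A = 1 -> 0 < complex.Im z -> mob_den A z != 0.
Proof.
case: z => x y /= dA y0; rewrite /mob_den eq_complex /=.
apply/negP => /andP[/eqP h1 /eqP h2].
have /eqP : A 1 0 * y = 0 by rewrite -[RHS]h2; ring.
rewrite mulf_eq0 (gt_eqF y0) orbF => /eqP c0.
move: h1 dA; rewrite det_2x2 c0 !mul0r !mulr0 !subr0 add0r => ->.
by rewrite mulr0 => /esym/eqP; rewrite oner_eq0.
Qed.

Lemma Im_mobius (A : 'M[R]_2) (z : R[i]) : \det A = 1 -> 0 < complex.Im z ->
  complex.Im (mobius A z) = complex.Im z / nsq (mob_den A z).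
Proof.
move=> dA y0; have /nsq_gt0/gt_eqF n0 := mob_den_neq0 dA y0.
move: dA n0; rewrite det_2x2 /mobius /mob_den /nsq.
case: z y0 => x y /= y0 dA n0.
by rewrite -[y / _]mul1r -dA; field; move: (negbT n0); rewrite !mul0r subr0 !addr0.
Qed.

(* The upper half-plane is {x + iy | y > 0}, with x + iy encoded as (x, y); the
   topology on pairs of reals is the product topology. *)
Definition half_plane : set (R * R) := [set z | 0 < z.2].
Definition H2 : Type := set_type half_plane.
HB.instance Definition _ := Topological.on H2.
HB.instance Definition _ := SubChoice.on H2.

(* A unit tangent vector is a pair (z, v) of a base point z and a Euclidean
   vector v of hyperbolic length |v| / Im z = 1. *)
Definition unit_tangent : set ((R * R) * (R * R)) :=
  [set w | half_plane w.1 /\ w.2.1 ^+ 2 + w.2.2 ^+ 2 = w.1.2 ^+ 2].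
Definition T1H2 : Type := set_type unit_tangent.
HB.instance Definition _ := Topological.on T1H2.
HB.instance Definition _ := SubChoice.on T1H2.

Definition mkH2 (z : R * R) (hz : half_plane z) : H2 := exist _ z (mem_set hz).
Definition mkT1H2 (w : (R * R) * (R * R)) (hw : unit_tangent w) : T1H2 :=
  exist _ w (mem_set hw).

Lemma H2_gt0 (z : H2) : 0 < (val z).2.
Proof. by case: z => z /= /set_mem. Qed.

Lemma T1H2P (w : T1H2) : unit_tangent (val w).
Proof. by case: w => w /= /set_mem. Qed.

Definition basept (w : T1H2) : H2 := mkH2 (T1H2P w).1.

Lemma H2_act_subproof (A : SL2 R) (z : H2) :
  half_plane (uncplx (mobius (val A) (cplx (val z)))).
Proof.
have z0 := H2_gt0 z.
suff : 0 < complex.Im (mobius (val A) (cplx (val z))) by [].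
rewrite Im_mobius ?SL2_det ?divr_gt0 //.
by apply/nsq_gt0/mob_den_neq0 => //; exact: SL2_det.
Qed.

Definition SL2_actH (A : SL2 R) (z : H2) : H2 :=
  mkH2 (H2_act_subproof A z).

Lemma T1H2_act_subproof (A : SL2 R) (w : T1H2) :
  unit_tangent (uncplx (mobius (val A) (cplx (val w).1)),
     uncplx (mobius_deriv (val A) (cplx (val w).1) * cplx (val w).2)).
Proof.
split; first exact: (H2_act_subproof A (basept w)).
have [z0 v1] := T1H2P w.
have d0 := mob_den_neq0 (SL2_det A) (z0 : 0 < complex.Im (cplx (val w).1)).
suff : nsq (mobius_deriv (val A) (cplx (val w).1) * cplx (val w).2) =
  complex.Im (mobius (val A) (cplx (val w).1)) ^+ 2 by [].
have nv : nsq (cplx (val w).2) = (val w).1.2 ^+ 2 by [].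
rewrite nsqM /mobius_deriv SL2_det mul1r nsqV expr2 nsqM nv.
by rewrite Im_mobius ?SL2_det // expr_div_n mulrC expr2.
Qed.

Definition SL2_actT (A : SL2 R) (w : T1H2) : T1H2 :=
  mkT1H2 (T1H2_act_subproof A w).

Lemma vertical_subproof (t : R) : unit_tangent ((0, expR t), (0, expR t)).
Proof. by split; rewrite /half_plane /= ?expR_gt0 // expr0n add0r. Qed.

(* vertical t = (e^t i, e^t i) is the velocity at time t of the unit-speed
   geodesic t |-> e^t i, whose positive endpoint is oo. *)
Definition vertical (t : R) : T1H2 := mkT1H2 (vertical_subproof t).

Lemma horizontal_subproof (s : R) : unit_tangent ((s, 1), (0, 1)).
Proof. by split; rewrite /half_plane /= ?ltr01 // expr0n add0r. Qed.

(* horizontal s = (s + i, i), for s in R, are the unit vectors based on the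
   horocycle {Im = 1} centered at oo and pointing towards oo. *)
Definition horizontal (s : R) : T1H2 :=
  mkT1H2 (horizontal_subproof s).

(* frame w is a matrix whose Moebius map sends (i, i) to w = (z, v), see frameP:
   if its lower row is (c, d) and r = ci + d, then v = i / r^2, and the upper row
   (a, b) satisfies ai + b = zr.  It is unique up to sign, see SL2_actT_free. *)
Definition frame_root (w : T1H2) : R[i] := sqrtc ('i / cplx (val w).2).
Definition frame_mx (w : T1H2) : 'M[R]_2 :=
  let r := frame_root w in let zr := cplx (val w).1 * r in
  mx2 (complex.Im zr) (complex.Re zr) (complex.Im r) (complex.Re r).

Lemma T1H2_vec_neq0 (w : T1H2) : cplx (val w).2 != 0.
Proof.
have [z0 v1] := T1H2P w; apply/eqP => /(congr1 nsq).
rewrite /nsq /= v1 !expr0n addr0 => /eqP; rewrite sqrf_eq0 => /eqP y0.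
by move: z0; rewrite /half_plane /= y0 ltxx.
Qed.

Lemma frame_root_neq0 (w : T1H2) : frame_root w != 0.
Proof.
by rewrite sqrtc_eq0 mulf_neq0 ?invr_eq0 ?T1H2_vec_neq0 // eq_complex /=
  oner_eq0 andbF.
Qed.

Lemma det_frame_mx (w : T1H2) : \det (frame_mx w) = 1.
Proof.
have [z0 v1] := T1H2P w.
have : nsq (frame_root w) ^+ 2 = ((val w).1.2 ^+ 2)^-1.
  rewrite expr2 -nsqM -expr2 sqr_sqrtc nsqM nsqV -v1.
  by rewrite /nsq /= expr0n expr1n add0r mul1r.
move/eqP; rewrite -exprVn eqf_sqr => /orP[/eqP e|/eqP e]; last first.
  have := nsq_gt0 (frame_root_neq0 w).
  by rewrite e oppr_gt0 invr_lt0 ltNge (ltW z0).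
rewrite det_2x2 !mxE /= [LHS](_ : _ = (val w).1.2 * nsq (frame_root w)).
  by rewrite e divff // gt_eqF.
rewrite /nsq /=; case: (frame_root w) => a b; case: (val w).1 => x y /=.
ring.
Qed.

Definition frame (w : T1H2) : SL2 R := mkSL2 (det_frame_mx w).


Lemma mulmx2E (A B : 'M[R]_2) i j :
  (A *m B) i j = A i 0 * B 0 j + A i 1 * B 1 j.
Proof.
rewrite mxE !big_ord_recl big_ord0 addr0.
by congr (A i _ * B _ j + A i _ * B _ j); exact/val_inj.
Qed.

Lemma mob_denM (A B : 'M[R]_2) z : mob_den B z != 0 ->
  mob_den (A *m B) z = mob_den A (mobius B z) * mob_den B z.
Proof.
rewrite /mob_den /mobius !mulmx2E !rmorphD !rmorphM /= => d0.
by rewrite /mob_den; field.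
Qed.

Lemma mobiusM (A B : 'M[R]_2) z :
    mob_den B z != 0 -> mob_den A (mobius B z) != 0 ->
  mobius (A *m B) z = mobius A (mobius B z).
Proof.
move=> d0 e0; rewrite {1}/mobius mob_denM // {2}/mobius.
apply: (mulIf (mulf_neq0 e0 d0)); rewrite divfK ?mulf_neq0 //.
rewrite mulrA divfK // !mulmx2E !rmorphD !rmorphM /=.
by move: d0; rewrite /mobius /mob_den => d0; field.
Qed.

Lemma mobius_derivM (A B : 'M[R]_2) z : mob_den B z != 0 ->
  mobius_deriv (A *m B) z = mobius_deriv A (mobius B z) * mobius_deriv B z.
Proof.
move=> d0; rewrite /mobius_deriv mob_denM // det_mulmx rmorphM /= exprMn invfM.
by ring.
Qed.

Lemma mob_den_SL2 (A : SL2 R) (z : H2) : mob_den (val A) (cplx (val z)) != 0.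
Proof. by apply: mob_den_neq0; [exact: SL2_det|exact: H2_gt0]. Qed.

Lemma mob_den_SL2' (A B : SL2 R) (z : H2) :
  mob_den (val A) (mobius (val B) (cplx (val z))) != 0.
Proof. by have := mob_den_SL2 A (SL2_actH B z); rewrite /= uncplxK. Qed.

Lemma SL2_actHM (A B : SL2 R) (z : H2) :
  SL2_actH (A * B)%g z = SL2_actH A (SL2_actH B z).
Proof.
apply: val_inj; rewrite /= uncplxK mobiusM //.
- exact: mob_den_SL2.
- exact: mob_den_SL2'.
Qed.

Lemma SL2_actH1 (z : H2) : SL2_actH 1%g z = z.
Proof.
apply: val_inj; rewrite /= /mobius /mob_den !mxE /=.
by rewrite mul1r mul0r addr0 add0r divr1 cplxK.
Qed.

Lemma SL2_actH_sign (A B : SL2 R) (z : H2) :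
  val A = - val B -> SL2_actH A z = SL2_actH B z.
Proof.
move=> AB; apply: val_inj; rewrite /= AB /mobius /mob_den !mxE !rmorphN /=.
by rewrite !mulNr -!opprD invrN mulrNN.
Qed.

Lemma basept_act (A : SL2 R) (w : T1H2) :
  basept (SL2_actT A w) = SL2_actH A (basept w).
Proof. exact: val_inj. Qed.

Lemma SL2_actTM (A B : SL2 R) (w : T1H2) :
  SL2_actT (A * B)%g w = SL2_actT A (SL2_actT B w).
Proof.
apply: val_inj => /=; rewrite !uncplxK mobiusM ?mobius_derivM ?mulrA //.
- exact: (mob_den_SL2 B (basept w)).
- exact: (mob_den_SL2 B (basept w)).
- exact: (mob_den_SL2' A B (basept w)).
Qed.

Lemma SL2_actT1 (w : T1H2) : SL2_actT 1%g w = w.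
Proof.
apply: val_inj => /=; rewrite [LHS]surjective_pairing /=.
have /(congr1 val) /= -> := SL2_actH1 (basept w).
rewrite /mobius_deriv /mob_den det1 !mxE /=.
rewrite mul0r add0r expr1n divr1 mul1r cplxK.
by rewrite -surjective_pairing.
Qed.

Lemma SL2_actT_sign (A B : SL2 R) (w : T1H2) :
  val A = - val B -> SL2_actT A w = SL2_actT B w.
Proof.
move=> AB; apply: val_inj => /=.
have /(congr1 val) /= -> := SL2_actH_sign (basept w) AB.
congr (_, uncplx (_ * _)); rewrite /mobius_deriv !SL2_det AB /mob_den.
by rewrite !mxE !rmorphN /= mulNr -opprD sqrrN.
Qed.

Lemma vertical0 : vertical 0 = horizontal 0.
Proof. by apply: val_inj; rewrite /= expR0. Qed.

Lemma frameP (w : T1H2) : SL2_actT (frame w) (horizontal 0) = w.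
Proof.
have r0 := frame_root_neq0 w; have v0 := T1H2_vec_neq0 w.
have split_i (x : R[i]) : (complex.Im x)%:C * (0 +i* 1) + (complex.Re x)%:C = x.
  by case: x => a b; apply/eqP; rewrite eq_complex /=; apply/andP; split;
    apply/eqP; ring.
have den : mob_den (val (frame w)) (0 +i* 1) = frame_root w.
  by rewrite /mob_den !mxE; exact: split_i.
apply: val_inj; rewrite /= [RHS]surjective_pairing; congr (_, _).
  rewrite -[RHS]cplxK; congr uncplx; rewrite /mobius den !mxE.
  by rewrite [X in X / _](split_i _) mulfK.
rewrite -[RHS]cplxK; congr uncplx; rewrite /mobius_deriv den det_frame_mx.
by rewrite sqr_sqrtc invf_div mul1r divfK // eq_complex /= oner_eq0 andbF.
Qed.

Lemma SL2_actT_free (A B : SL2 R) :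
  SL2_actT A (horizontal 0) = SL2_actT B (horizontal 0) -> sign_rel A B.
Proof.
have linE (a b : R) : a%:C * (0 +i* 1) + b%:C = b +i* a.
  by apply/eqP; rewrite eq_complex /=; apply/andP; split; apply/eqP; ring.
have dA0 := mob_den_SL2 A (basept (horizontal 0)).
have dB0 := mob_den_SL2 B (basept (horizontal 0)).
move=> /(congr1 val) AB.
have := can_inj uncplxK (congr1 fst AB).
have := can_inj uncplxK (congr1 snd AB).
move: dA0 dB0 {AB}; rewrite /= -[cplx (0, 1)]/(0 +i* 1).
set dA := mob_den _ _ => dA0; set dB := mob_den _ _ => dB0.
rewrite /mobius_deriv !SL2_det !mul1r -/dA -/dB => h.
have i0 : (0 +i* 1 : R[i]) != 0 by rewrite eq_complex /= oner_eq0 andbF.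
have /eqP := invr_inj (mulIf i0 h); rewrite eqf_sqr => {h i0} hd.
rewrite /mobius -/dA -/dB linE.
rewrite linE => hm; rewrite /sign_rel.
have ext (s : R) : (forall i, val A i 0 = s * val B i 0) ->
    (forall i, val A i 1 = s * val B i 1) -> val A = s *: val B.
  move=> h0 h1; apply/matrixP => i j; rewrite !mxE.
  have [->|->] : j = 0 \/ j = 1.
    by case: j => [[|[|//]] lt]; [left|right]; exact/val_inj.
  - exact: h0.
  - exact: h1.
have I2 (P : 'I_2 -> Prop) : P 0 -> P 1 -> forall i, P i.
  move=> P0 P1 i; have [->//|->//] : i = 0 \/ i = 1.
    by case: i => [[|[|//]] lt]; [left|right]; exact/val_inj.
have dAE : dA = (val A) 1 1 +i* (val A) 1 0 by exact: linE.
have dBE : dB = (val B) 1 1 +i* (val B) 1 0 by exact: linE.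
case/orP: hd => /eqP hd; apply/orP.
  left; rewrite -[val B]scale1r; apply/eqP.
  move: hm; rewrite hd => hm.
  case: (mulIf (invr_neq0 dB0) hm) => e01 e00.
  move: hd; rewrite dAE dBE => -[e11 e10].
  by apply: ext; apply: I2; rewrite mul1r.
right; rewrite -scaleN1r; apply/eqP.
move: hm; rewrite hd invrN mulrN -mulNr => hm.
case: (mulIf (invr_neq0 dB0) hm) => e01 e00.
move: hd; rewrite dAE dBE => -[e11 e10].
apply: ext; apply: I2; rewrite mulN1r // -?e01 -?e00 ?opprK //.
Qed.

(* The orientation-preserving isometry frame w sends (i, i) to w, hence carries
   the geodesic and the horocycle of (i, i) to those of w. *)
Definition geodesic_flow (t : R) (w : T1H2) : T1H2 :=
  SL2_actT (frame w) (vertical t).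
Definition horocycle_flow (s : R) (w : T1H2) : T1H2 :=
  SL2_actT (frame w) (horizontal s).

Lemma frame_act (A : SL2 R) (w : T1H2) :
  sign_rel (frame (SL2_actT A w)) (A * frame w)%g.
Proof. by apply: SL2_actT_free; rewrite SL2_actTM !frameP. Qed.

Lemma sign_rel_actT (A B : SL2 R) (w : T1H2) :
  sign_rel A B -> SL2_actT A w = SL2_actT B w.
Proof. by case/orP => /eqP AB; [rewrite (val_inj AB)|exact: SL2_actT_sign]. Qed.

Lemma geodesic_flow_act (A : SL2 R) t (w : T1H2) :
  geodesic_flow t (SL2_actT A w) = SL2_actT A (geodesic_flow t w).
Proof. by rewrite /geodesic_flow (sign_rel_actT _ (frame_act A w)) SL2_actTM. Qed.

Lemma horocycle_flow_act (A : SL2 R) s (w : T1H2) :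
  horocycle_flow s (SL2_actT A w) = SL2_actT A (horocycle_flow s w).
Proof. by rewrite /horocycle_flow (sign_rel_actT _ (frame_act A w)) SL2_actTM. Qed.

Lemma geodesic_flow_vertical t : geodesic_flow t (vertical 0) = vertical t.
Proof.
rewrite /geodesic_flow -[RHS]SL2_actT1; apply/sign_rel_actT/SL2_actT_free.
by rewrite vertical0 frameP SL2_actT1.
Qed.

Lemma horocycle_flow_horizontal s :
  horocycle_flow s (horizontal 0) = horizontal s.
Proof.
rewrite /horocycle_flow -[RHS]SL2_actT1; apply/sign_rel_actT/SL2_actT_free.
by rewrite frameP SL2_actT1.
Qed.

End HyperbolicPlane.

Section HyperbolicDistance.
Variable R : realType.
Implicit Types (A : SL2 R) (z w : H2 R).

(* cosh d(z, w) = 1 + |z - w|^2 / (2 Im z Im w). *)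
Definition acosh (x : R) : R := ln (x + Num.sqrt (x ^+ 2 - 1)).

Definition dist_H2 z w : R :=
  acosh (1 + nsq (cplx (val z) - cplx (val w)) /
             (2 * (val z).2 * (val w).2)).

Lemma dist_H2_act A z w : dist_H2 (SL2_actH A z) (SL2_actH A w) = dist_H2 z w.
Proof.
have dz0 := mob_den_SL2 A z; have dw0 := mob_den_SL2 A w.
have z0 := H2_gt0 z; have w0 := H2_gt0 w.
have nz0 := nsq_gt0 dz0; have nw0 := nsq_gt0 dw0.
congr (acosh (1 + _)).
have Iz : (val (SL2_actH A z)).2 = (val z).2 / nsq (mob_den (val A) (cplx (val z))).
  by rewrite -[LHS]/(complex.Im _) Im_mobius //; exact: SL2_det.
have Iw : (val (SL2_actH A w)).2 = (val w).2 / nsq (mob_den (val A) (cplx (val w))).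
  by rewrite -[LHS]/(complex.Im _) Im_mobius //; exact: SL2_det.
have diff : cplx (val (SL2_actH A z)) - cplx (val (SL2_actH A w)) =
    (cplx (val z) - cplx (val w)) /
    (mob_den (val A) (cplx (val z)) * mob_den (val A) (cplx (val w))).
  have d1 : (\det (val A))%:C = 1 :> R[i] by rewrite SL2_det.
  rewrite /= !uncplxK -[in RHS](mul1r (cplx _ - _)) -[in RHS]d1 det_2x2.
  rewrite rmorphB !rmorphM /mobius /= => {Iz Iw nz0 nw0}.
  by move: dz0 dw0; rewrite /mob_den => dz0 dw0; field; apply/andP.
rewrite Iz Iw diff nsqM nsqV nsqM; field.
by rewrite !gt_eqF.
Qed.

End HyperbolicDistance.

Section Fuchsian.
Variable R : realType.

Definition PSL2_actH (g : PSL2 R) (z : H2 R) : H2 R := SL2_actH (repr g) z.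
Definition PSL2_actT (g : PSL2 R) (w : T1H2 R) : T1H2 R := SL2_actT (repr g) w.

Lemma PSL2_actH_pi (A : SL2 R) z : PSL2_actH (\pi A) z = SL2_actH A z.
Proof.
have [/val_inj e|e] := PSL2_repr_pi A; rewrite /PSL2_actH ?e //.
exact: SL2_actH_sign.
Qed.

Lemma PSL2_actT_pi (A : SL2 R) w : PSL2_actT (\pi A) w = SL2_actT A w.
Proof.
have [/val_inj e|e] := PSL2_repr_pi A; rewrite /PSL2_actT ?e //.
exact: SL2_actT_sign.
Qed.

Lemma PSL2_actHM (g h : PSL2 R) z :
  PSL2_actH (g * h)%g z = PSL2_actH g (PSL2_actH h z).
Proof. by rewrite PSL2_actH_pi SL2_actHM. Qed.

Lemma PSL2_actH1 z : PSL2_actH 1%g z = z.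
Proof. by rewrite PSL2_actH_pi SL2_actH1. Qed.

Lemma PSL2_actTM (g h : PSL2 R) w :
  PSL2_actT (g * h)%g w = PSL2_actT g (PSL2_actT h w).
Proof. by rewrite PSL2_actT_pi SL2_actTM. Qed.

Lemma PSL2_actT1 w : PSL2_actT 1%g w = w.
Proof. by rewrite PSL2_actT_pi SL2_actT1. Qed.

Definition elliptic (g : PSL2 R) : Prop :=
  g <> 1%g /\ exists z, PSL2_actH g z = z.

(* Discreteness: every element is isolated for the quotient topology of PSL2. *)
Record fuchsian := Fuchsian {
  fuchsian_set :> PSL2 R -> Prop;
  fuchsian_group : group_closed (mem (fuchsian_set : set _));
  fuchsian_discrete : fuchsian_set `<=` isolated fuchsian_set }.

End Fuchsian.

Section Quotients.
Variables (R : realType) (G : fuchsian R).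

Lemma fuchsian1 : G 1%g.
Proof. exact/set_mem/(fuchsian_group G).1. Qed.

Lemma fuchsianV g : G g -> G g^-1%g.
Proof. by move=> /mem_set/(group_closedV (fuchsian_group G))/set_mem. Qed.

Lemma fuchsianM g h : G g -> G h -> G (g * h)%g.
Proof.
by move=> /mem_set Gg /mem_set Gh; apply/set_mem/(group_closedM (fuchsian_group G)).
Qed.

Definition orbit_relH (z z' : H2 R) : bool :=
  `[< exists2 g, G g & PSL2_actH g z = z' >].
Definition orbit_relT (w w' : T1H2 R) : bool :=
  `[< exists2 g, G g & PSL2_actT g w = w' >].

Lemma orbit_relH_equiv : equiv_class_of orbit_relH.
Proof.
have sym z z' : orbit_relH z z' -> orbit_relH z' z.
  move=> /asboolP[g Gg <-]; apply/asboolP; exists g^-1%g.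
    exact: fuchsianV.
  by rewrite -PSL2_actHM mulVg PSL2_actH1.
split=> [z|z z'|z' z z''].
- by apply/asboolP; exists 1%g; [exact: fuchsian1|exact: PSL2_actH1].
- by apply/idP/idP; exact: sym.
- move=> /asboolP[g Gg <-] /asboolP[h Gh <-]; apply/asboolP.
  by exists (h * g)%g; [exact: fuchsianM|rewrite PSL2_actHM].
Qed.

Lemma orbit_relT_equiv : equiv_class_of orbit_relT.
Proof.
have sym z z' : orbit_relT z z' -> orbit_relT z' z.
  move=> /asboolP[g Gg <-]; apply/asboolP; exists g^-1%g.
    exact: fuchsianV.
  by rewrite -PSL2_actTM mulVg PSL2_actT1.
split=> [z|z z'|z' z z''].
- by apply/asboolP; exists 1%g; [exact: fuchsian1|exact: PSL2_actT1].
- by apply/idP/idP; exact: sym.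
- move=> /asboolP[g Gg <-] /asboolP[h Gh <-]; apply/asboolP.
  by exists (h * g)%g; [exact: fuchsianM|rewrite PSL2_actTM].
Qed.

Canonical orbit_equivH := EquivRelPack orbit_relH_equiv.
Canonical orbit_equivT := EquivRelPack orbit_relT_equiv.

Definition surface : Type := quotient_topology {eq_quot orbit_equivH}.
HB.instance Definition _ := Topological.on surface.
HB.instance Definition _ := Quotient.on surface.

Definition T1S : Type := quotient_topology {eq_quot orbit_equivT}.
HB.instance Definition _ := Topological.on T1S.
HB.instance Definition _ := Quotient.on T1S.

Lemma surface_eqP (z z' : H2 R) :
  reflect (\pi_surface z = \pi_surface z') (orbit_relH z z').
Proof. exact: (@eqquotP _ _ {eq_quot orbit_equivH} z z'). Qed.

Lemma T1S_eqP (w w' : T1H2 R) :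
  reflect (\pi_T1S w = \pi_T1S w') (orbit_relT w w').
Proof. exact: (@eqquotP _ _ {eq_quot orbit_equivT} w w'). Qed.

Lemma surface_repr_pi z :
  exists2 g, G g & repr (\pi_surface z) = PSL2_actH g z.
Proof.
have /esym/surface_eqP/asboolP[g Gg <-] :
  \pi_surface (repr (\pi_surface z)) = \pi_surface z by rewrite reprK.
by exists g.
Qed.

Lemma T1S_repr_pi w : exists2 g, G g & repr (\pi_T1S w) = PSL2_actT g w.
Proof.
have /esym/T1S_eqP/asboolP[g Gg <-] :
  \pi_T1S (repr (\pi_T1S w)) = \pi_T1S w by rewrite reprK.
by exists g.
Qed.

(* The flows and the base point descend to the quotient, see geodesic_flowS_pi,
   horocycle_flowS_pi and baseptS_pi. *)
Definition geodesic_flowS (t : R) (u : T1S) : T1S :=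
  \pi_T1S (geodesic_flow t (repr u)).
Definition horocycle_flowS (s : R) (u : T1S) : T1S :=
  \pi_T1S (horocycle_flow s (repr u)).
Definition baseptS (u : T1S) : surface := \pi_surface (basept (repr u)).

Lemma geodesic_flowS_pi t w :
  geodesic_flowS t (\pi_T1S w) = \pi_T1S (geodesic_flow t w).
Proof.
have [g Gg e] := T1S_repr_pi w; rewrite /geodesic_flowS e.
apply/esym/T1S_eqP/asboolP; exists g => //.
by rewrite /PSL2_actT geodesic_flow_act.
Qed.

Lemma horocycle_flowS_pi s w :
  horocycle_flowS s (\pi_T1S w) = \pi_T1S (horocycle_flow s w).
Proof.
have [g Gg e] := T1S_repr_pi w; rewrite /horocycle_flowS e.
apply/esym/T1S_eqP/asboolP; exists g => //.
by rewrite /PSL2_actT horocycle_flow_act.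
Qed.

Lemma baseptS_pi w : baseptS (\pi_T1S w) = \pi_surface (basept w).
Proof.
have [g Gg e] := T1S_repr_pi w; rewrite /baseptS e.
by apply/esym/surface_eqP/asboolP; exists g => //; exact/esym/basept_act.
Qed.

(* The quotient distance: infimum of the distances between lifts. *)
Definition dist_surface (p q : surface) : R :=
  inf [set d | exists z w,
    [/\ \pi_surface z = p, \pi_surface w = q & d = dist_H2 z w]].

(* A minimum for discrete G; it is +oo if G is trivial.  See Inj_pi for the
   independence of the lift. *)
Definition Inj (p : surface) : \bar R :=
  ereal_inf [set (dist_H2 (repr p) (PSL2_actH g (repr p)))%:E |
             g in [set g | G g /\ g <> 1%g]].

Lemma Inj_pi z : Inj (\pi_surface z) =
  ereal_inf [set (dist_H2 z (PSL2_actH g z))%:E | g in [set g | G g /\ g <> 1%g]].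
Proof.
have [h Gh e] := surface_repr_pi z; rewrite /Inj e; congr ereal_inf.
have distJ x y : dist_H2 (PSL2_actH h x) (PSL2_actH h y) = dist_H2 x y.
  exact: dist_H2_act.
apply/seteqP; split => _ [g [Gg g1] <-].
- exists (g ^ h)%g.
    split; last by apply/eqP; rewrite conjg_eq1; exact/eqP.
    by rewrite conjgE; do ![apply: fuchsianM => //|exact: fuchsianV].
  by rewrite -distJ -!PSL2_actHM conjgE mulVKg PSL2_actHM.
- exists (g ^ h^-1)%g.
    split; last by apply/eqP; rewrite conjg_eq1; exact/eqP.
    by rewrite conjgE; do ![apply: fuchsianM => //|apply: fuchsianV => //].
  by rewrite -PSL2_actHM conjgE invgK -!mulgA mulVg mulg1 PSL2_actHM distJ.
Qed.

Definition non_wandering : set T1S :=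
  [set u | forall V : set T1S, nbhs u V ->
    exists s : nat -> R, s n @[n --> \oo] --> +oo /\
      forall n, (horocycle_flowS (s n) @` V) `&` V !=set0].

Definition almost_minimizing (u : T1S) : Prop :=
  exists2 C : R, 0 < C & forall t : R, 0 < t ->
    dist_surface (baseptS u) (baseptS (geodesic_flowS t u)) > t - C.

Definition horocycle_orbit (u : T1S) : set T1S :=
  range (fun s : R => horocycle_flowS s u).

Definition horocycle_periodic (u : T1S) : Prop :=
  exists2 s : R, 0 < s & horocycle_flowS s u = u.

Definition liminf_Inj (u : T1S) : \bar R :=
  limf_einf (fun t : R => Inj (baseptS (geodesic_flowS t u))) (pinfty_nbhs R).

End Quotients.

Section FundamentalGroup.
Variables (R : realType) (X : topologicalType).

Definition is_loop (x0 : X) (f : R -> X) : Prop :=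
  [/\ {within `[0, 1], continuous f}, f 0 = x0 & f 1 = x0].

Definition loop_cat (f g : R -> X) (t : R) : X :=
  if t <= 2^-1 then f (2 * t) else g (2 * t - 1).
Definition loop_inv (f : R -> X) (t : R) : X := f (1 - t).

Definition loop_homotopic (x0 : X) (f g : R -> X) : Prop :=
  exists F : R * R -> X,
  [/\ {within [set` `[0, 1]] `*` [set` `[0, 1]], continuous F},
      {in `[0, 1], forall t, F (0, t) = f t},
      {in `[0, 1], forall t, F (1, t) = g t} &
      {in `[0, 1], forall s, F (s, 0) = x0 /\ F (s, 1) = x0}].

Definition loop_word (x0 : X) n (gen : 'I_n -> R -> X)
    (w : seq ('I_n * bool)) : R -> X :=
  foldr (fun a f => loop_cat (if a.2 then loop_inv (gen a.1) else gen a.1) f)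
        (cst x0) w.

(* Every loop at x0 is homotopic rel endpoints to a word in finitely many loops
   and their inverses. *)
Definition pi1_finitely_generated (x0 : X) : Prop :=
  exists n (gen : 'I_n -> R -> X), (forall i, is_loop x0 (gen i)) /\
    forall f, is_loop x0 f -> exists w, loop_homotopic x0 f (loop_word x0 gen w).

End FundamentalGroup.

Definition geometrically_finite (R : realType) (G : fuchsian R) : Prop :=
  forall p : surface G, pi1_finitely_generated R p.

(* Main.v *)
Require Import Defs.
From mathcomp Require Import all_boot all_order all_algebra generic_quotient.
From mathcomp Require Import complex ring lra.
From mathcomp Require Import all_classical reals ereal topology normedtype.
From mathcomp Require Import sequences exp.

Set Implicit Arguments.
Unset Strict Implicit.
Unset Printing Implicit Defensive.

Import Order.TTheory GRing.Theory Num.Theory.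
Import numFieldNormedType.Exports.

Local Open Scope classical_set_scope.
Local Open Scope ring_scope.
Local Open Scope quotient_scope.

(** Let w be a lift of u and F a matrix carrying the vector (i, i) to w.  After
    conjugation by F the ray u(R^+) becomes the vertical ray {iy : y >= 1}; let
    L be the group of matrices A = [a b; c d] such that F A F^-1 lies over
    Gamma.  The horocycle flow is the action of upper unipotent matrices on the
    right, which fixes the first column, so the vectors in the closure of the
    horocycle orbit are read off from the limits of the first columns (a, c) of
    the elements of L: the vector g_(2 ln T) u belongs to this closure as soon
    as (T, 0) is such a limit ([axis_limit_closure]).  The task is thus to find
    elements of L with c small and a prescribed.

    Since cosh d(iy, A iy) = (a^2 + d^2 + c^2 y^2 + b^2 / y^2) / 2, a bounded
    injectivity radius at heights y going to infinity yields elements of L,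
    other than 1 and -1, with a and d bounded and c tending to 0
    ([liminf_Inj_normalized]).  Here c is not 0: an element fixing oo is either
    parabolic, and then u is periodic for the horocycle flow, or hyperbolic, and
    then some of its powers have a first column close to 0.  But a^2 + c^2
    is bounded below on L because the ray is almost minimizing: it is the limit
    of exp(d(i, A iy)) / y as y goes to infinity ([almost_minimizing_ge],
    [stab_infty_trivial]).  As L has no elliptic element, |a + d| >= 2, and
    replacing A by -A or by A^-1 one may assume a + d >= 2 and a >= d, so that
    a >= 1.

    The limits (T, 0) then come from powers A^j of these elements.
    If a stays above 1 + eta, a fixed power A^k has its upper left entry in a
    bounded interval above 1 + k eta and its lower left entry still tends to 0;
    a limit of the upper left entries exists and is as large as one wishes
    ([axis_limit_far_id]).
    Otherwise there are such elements with a and d tending to 1.  By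
    discreteness b is then unbounded ([framed_bottom_left_isolated]), which
    makes c small compared with a - 1.  The upper left entries of the powers of
    A grow from 1 to infinity by small steps, while the lower left entries stay
    small until the upper left ones reach T: every T >= 1 is obtained
    ([axis_limit_near_id]).  If the lower limit of the injectivity radius is 0
    one is in this second case, since
    (a - 1)^2 + (d - 1)^2 + c^2 y^2 <= 2 (cosh d(iy, A iy) - 1)
    ([short_normalize]). *)

(** * Entries of matrices of determinant one *)

Section Matrices.
Variable R : realType.
Implicit Types (A B : SL2 R) (M N : 'M[R]_2).

Lemma ord2P (P : 'I_2 -> Prop) : P 0 -> P 1 -> forall i, P i.
Proof.
move=> P0 P1 i; have [->//|->//] : i = 0 \/ i = 1.
by case: i => [[|[|//]] lt]; [left|right]; exact/val_inj.
Qed.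

Lemma mx2_ext M N : M 0 0 = N 0 0 -> M 0 1 = N 0 1 -> M 1 0 = N 1 0 ->
  M 1 1 = N 1 1 -> M = N.
Proof. by move=> *; apply/matrixP => i j; elim/ord2P: i; elim/ord2P: j. Qed.

Lemma SL2_detE A : val A 0 0 * val A 1 1 - val A 0 1 * val A 1 0 = 1.
Proof. by rewrite -det_2x2 SL2_det. Qed.

Lemma SL2_invE A :
  val A^-1%g = mx2 (val A 1 1) (- val A 0 1) (- val A 1 0) (val A 0 0).
Proof.
have e := SL2_detE A.
have eV : val A *m val A^-1%g = 1%:M := congr1 val (mulgV A).
apply: (can_inj (mulKmx (SL2_unit A))); rewrite eV.
by apply: mx2_ext; rewrite mulmx2E !mxE /= -?[in LHS]e; ring.
Qed.

Lemma det_mx2 (a b c d : R) : \det (mx2 a b c d) = a * d - b * c.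
Proof. by rewrite det_2x2 !mxE. Qed.

Lemma mx2E (a b c d : R) : ((mx2 a b c d 0 0 = a) * (mx2 a b c d 0 1 = b)) *
  ((mx2 a b c d 1 0 = c) * (mx2 a b c d 1 1 = d)).
Proof. by rewrite !mxE. Qed.

Lemma SL2_entries A : exists a b c d,
  val A = mx2 a b c d /\ a * d - b * c = 1.
Proof.
exists (val A 0 0), (val A 0 1), (val A 1 0), (val A 1 1).
by split; [apply: mx2_ext; rewrite mx2E|exact: SL2_detE].
Qed.

Lemma SL2_opp_subproof A : \det (- val A) = 1.
Proof. by rewrite det_2x2 !mxE !mulrNN SL2_detE. Qed.
Definition SL2_opp A : SL2 R := mkSL2 (SL2_opp_subproof A).

Lemma pi_SL2_opp A : \pi_(PSL2 R) (SL2_opp A) = \pi_(PSL2 R) A.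
Proof. by apply/PSL2_eqP; rewrite /sign_rel /= eqxx orbT. Qed.

Lemma piM A B : \pi_(PSL2 R) (A * B)%g = (\pi_(PSL2 R) A * \pi_(PSL2 R) B)%g.
Proof. by rewrite -PSL2_mul_pi. Qed.

Lemma piV A : \pi_(PSL2 R) A^-1%g = (\pi_(PSL2 R) A)^-1%g.
Proof. by rewrite -PSL2_inv_pi. Qed.

Lemma pi_SL2_id_bottom_left A : \pi_(PSL2 R) A = 1%g -> val A 1 0 = 0.
Proof.
by move=> /PSL2_eqP/orP[]/eqP ->; rewrite !mxE ?oppr0.
Qed.

End Matrices.

(** * Powers of a matrix of determinant one *)
Section Powers.
Variable R : realType.
Implicit Types (a th T e : R) (A : SL2 R).

(** With u_j = U_(j-1)(1 + th / 2), for U the Chebyshev polynomials of the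
    second kind, this is the pair (u_j - u_(j-1), u_j): by Cayley-Hamilton, u_j
    governs the powers of a matrix of trace 2 + th and determinant 1.  The
    difference is kept as first component because both components are visibly
    nonnegative and monotone in th when th >= 0. *)
Fixpoint chebyshev th (j : nat) : R * R :=
  if j is i.+1 then
    let: (v, u) := chebyshev th i in (v + th * u, u + (v + th * u))
  else (1, 0).

Definition power_corner th a j :=
  (chebyshev th j).1 + (a - 1) * (chebyshev th j).2.

Lemma SL2_powE A a b c d th j : val A = mx2 a b c d -> a + d = 2 + th ->
  val (A ^+ j)%g 0 0 = power_corner th a j /\
  val (A ^+ j)%g 1 0 = c * (chebyshev th j).2.
Proof.
move=> EA tr; have := SL2_detE A; rewrite EA !mx2E => det.
have dE : d = 2 + th - a by rewrite -tr; ring.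
rewrite /power_corner; elim: j => [|j [IH0 IH1]].
  by rewrite expg0 /= !mxE /= !mulr0 addr0.
rewrite expgS /= !mulmx2E IH0 IH1 EA !mx2E; case: (chebyshev th j) => v u /=.
have bcE : b * c = a * (2 + th - a) - 1.
  by rewrite -dE -det; ring.
by split; [rewrite mulrA bcE; ring|rewrite dE; ring].
Qed.

Lemma chebyshev_ge th j : 0 <= th ->
  1 <= (chebyshev th j).1 /\ 0 <= (chebyshev th j).2.
Proof.
move=> th0; elim: j => [|j] /=; first by rewrite lexx.
case: (chebyshev th j) => v u /= [v1 u0].
by have := mulr_ge0 th0 u0; split; lra.
Qed.

(** The quadratic form u^2 - (2 + th) u u' + u'^2 is invariant under the
    recurrence satisfied by the u_j.  In terms of u and v = u - u' it gives
    th u^2 <= v^2 + th u v, which bounds the steps in [power_corner_dense]. *)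
Lemma chebyshev_invariant th j :
  (chebyshev th j).1 ^+ 2 + th * (chebyshev th j).2 * (chebyshev th j).1
  - th * (chebyshev th j).2 ^+ 2 = 1.
Proof.
elim: j => [|j] /=; first by rewrite expr0n /= !mulr0 mul0r expr1n addr0 subr0.
by case: (chebyshev th j) => v u /= <-; ring.
Qed.

Lemma chebyshev_mono th th' j : 0 <= th <= th' ->
  (chebyshev th j).1 <= (chebyshev th' j).1 /\
  (chebyshev th j).2 <= (chebyshev th' j).2.
Proof.
case/andP => th0 hth; elim: j => [|j] /=; first by rewrite !lexx.
have [_] := chebyshev_ge j th0.
move: (chebyshev th j) (chebyshev th' j) => [v u] [v' u'] /=.
move=> u0 [hv hu]; have : th * u <= th' * u' by exact: ler_pM.
by split; lra.
Qed.

Lemma power_corner_succ th a j : power_corner th a j.+1 - power_corner th a j =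
  th * (chebyshev th j).2 +
  (a - 1) * ((chebyshev th j).1 + th * (chebyshev th j).2).
Proof. by rewrite /power_corner /=; case: (chebyshev th j) => v u /=; ring. Qed.

Lemma power_corner_ge th a j : 0 <= th -> 1 <= a ->
  1 + j%:R * (a - 1) <= power_corner th a j.
Proof.
move=> th0 a1; elim: j => [|j IH].
  by rewrite /power_corner /= mul0r mulr0 !addr0.
rewrite -(subrK (power_corner th a j) (power_corner th a j.+1)).
rewrite power_corner_succ.
have [v1 u0] := chebyshev_ge j th0; have tu := mulr_ge0 th0 u0.
have : 1 * (a - 1) <= ((chebyshev th j).1 + th * (chebyshev th j).2) * (a - 1).
  by apply: ler_wpM2r; lra.
rewrite -natr1; move: IH tu.
move: (th * _) => w.
move: (power_corner _ _ _) (j%:R : R) (chebyshev th j).1 => x y v.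
by move=> *; lra.
Qed.

(** The upper left entries x_j of the powers go from 1 to infinity, so that
    it suffices to stop just below T and to bound the step
    th u + (a - 1) (v + th u).  Below T one has v <= T and (a - 1) u <= T, hence
    th u <= 2 T, and [chebyshev_invariant] gives
    (th u)^2 <= th (v^2 + th u v) <= 6 (a - 1) T^2.  The bound on (a - 1) u is
    also what keeps the lower left entry c u small. *)
Lemma power_corner_dense T e : 1 <= T -> 0 < e -> exists2 eta, 0 < eta &
  forall a th, 0 < a - 1 < eta -> 0 <= th <= 2 * (a - 1) ->
  exists j, `|power_corner th a j - T| < e /\ (a - 1) * (chebyshev th j).2 <= T.
Proof.
move=> T1 e0.
(* The two terms make (a - 1) (v + th u) and th u smaller than e / 2. *)
pose eta := Num.min (e / (6 * T)) (e ^+ 2 / (24 * T ^+ 2)).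
have T0 : 0 < T by lra.
have eta0 : 0 < eta.
  by rewrite lt_min !divr_gt0 ?exprn_gt0 ?mulr_gt0 ?exprn_gt0.
exists eta => // a th /andP[a0 aeta] /andP[th0 th2].
have /andP[h1 h2] : (a - 1 < e / (6 * T)) && (a - 1 < e ^+ 2 / (24 * T ^+ 2)).
  by rewrite -lt_min.
rewrite ltr_pdivlMr ?mulr_gt0 // in h1.
rewrite ltr_pdivlMr ?mulr_gt0 ?exprn_gt0 // in h2.
have [T1'|Tn1] := eqVneq T 1.
  exists 0%N; rewrite /power_corner /= !mulr0 addr0 T1' subrr normr0.
  by split => //; lra.
have exj : exists j, T <= power_corner th a j.
  have := archi_boundP (ltW (divr_gt0 T0 a0)); set k := Num.bound _ => hk.
  exists k; apply: le_trans (power_corner_ge k th0 _); last by lra.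
  by move: hk; rewrite ltr_pdivrMr // => ?; lra.
case: (ex_minnP exj) => -[|j] hj minj.
  by move: hj; rewrite /power_corner /= mulr0 addr0 => ?; move/eqP: Tn1; lra.
have xT : power_corner th a j < T.
  by rewrite ltNge; apply/negP => /minj; rewrite ltnn.
exists j; have := power_corner_succ th a j; have := chebyshev_invariant th j.
have [v1 u0] := chebyshev_ge j th0.
move: xT hj; rewrite /power_corner; move: (chebyshev th j.+1) => -[v' u'].
move: (chebyshev th j) v1 u0 => [v u] /= v1 u0 xT hj inv step.
have au0 : 0 <= (a - 1) * u by apply: mulr_ge0 => //; lra.
have auT : (a - 1) * u <= T by lra.
have vT : v <= T by lra.
have tu0 : 0 <= th * u by exact: mulr_ge0.
have tuT : th * u <= 2 * T.
  by apply: (@le_trans _ _ (2 * (a - 1) * u)); [exact: ler_wpM2r|lra].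
have tuv : th * u * v <= 2 * T * T by apply: ler_pM => //; lra.
have vv : v ^+ 2 <= T * T by rewrite expr2; apply: ler_pM => //; lra.
have tuu : (th * u) ^+ 2 <= 2 * (a - 1) * (3 * T ^+ 2).
  rewrite (_ : _ ^+ 2 = th * (th * u ^+ 2)); last by ring.
  apply: ler_pM => //; first by rewrite mulr_ge0 // sqr_ge0.
  by rewrite expr2; lra.
have tue : th * u < e / 2.
  rewrite -(ltr_pXn2r (n := 2)) ?nnegrE //; last by lra.
  rewrite (_ : (e / 2) ^+ 2 = e ^+ 2 / 4); last by field.
  apply: le_lt_trans tuu _; rewrite ltr_pdivlMr //.
  by rewrite (_ : _ * 4 = (a - 1) * (24 * T ^+ 2)); last by ring.
have : (a - 1) * (v + th * u) <= (a - 1) * (3 * T) by apply: ler_wpM2l; lra.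
by move=> av; split => //; rewrite ltr_norml; apply/andP; split; lra.
Qed.

End Powers.

(** * Limits of first columns on the axis *)
Section AxisLimits.
Variables (R : realType) (L : set (SL2 R)).
Hypothesis L1 : L 1%g.
Hypothesis LM : forall A B, L A -> L B -> L (A * B)%g.

(** The vector (T, 0) of the plane is in the closure of the orbit of (1, 0)
    under L. *)
Definition axis_limit (T : R) : Prop := forall e, 0 < e ->
  exists A : SL2 R, [/\ L A, `|val A 0 0 - T| < e & `|val A 1 0| < e].

(** The form in which the discreteness of L is used: elements with c tending to
    0 while c is not 0 must leave every compact set of matrices. *)
Definition bottom_left_isolated : Prop :=
  forall K : R, exists2 delta, 0 < delta &
  forall A : SL2 R, L A -> `|val A 0 0| <= K -> `|val A 0 1| <= K ->
    `|val A 1 1| <= K -> `|val A 1 0| < delta -> val A 1 0 = 0.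

Lemma power_closed A j : L A -> L (A ^+ j)%g.
Proof.
by move=> LA; elim: j => [|j IH]; rewrite ?expg0 // expgS; exact: LM.
Qed.

(** From b c = a d - 1 and |a d - 1| <= 3 (a - 1) for a <= 2, an entry b
    larger than 3 T / e forces |c| u < e as long as (a - 1) u <= T, which is
    the range of powers provided by [power_corner_dense]. *)
Lemma axis_limit_near_id : bottom_left_isolated ->
  (forall e, 0 < e -> exists A : SL2 R,
    [/\ L A, val A 1 0 != 0, `|val A 1 0| < e,
     2 <= val A 0 0 + val A 1 1 & val A 1 1 <= val A 0 0 < 1 + e]) ->
  forall T, 1 <= T -> axis_limit T.
Proof.
move=> disc near1 T T1 e e0.
have [eta eta0 dense] := power_corner_dense T1 e0.
have [K K2 KT] : exists2 K, 2 <= K & 3 * T <= e * K.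
  exists (Num.max 2 (3 * T / e)); first by rewrite le_max lexx.
  by rewrite (mulrC e) -ler_pdivrMr // le_max lexx orbT.
have [delta delta0 discK] := disc K.
have [e' e'0 [e'1 e'eta e'delta]] : exists2 e', 0 < e' &
    [/\ e' <= 1, e' <= eta & e' <= delta].
  exists (Num.min 1 (Num.min eta delta)); first by rewrite !lt_min ltr01 eta0.
  by rewrite !ge_min !lexx !orbT.
have [A [LA]] := near1 _ e'0.
have [a [b [c [d [EA det]]]]] := SL2_entries A.
rewrite EA !mx2E => c0 cs tr2 /andP[da a1].
have cdelta := lt_le_trans cs e'delta.
have bK : K < `|b|.
  rewrite ltNge; apply/negP => bK; move/eqP: c0; apply.
  have := discK A LA; rewrite EA !mx2E; apply=> //;
    by rewrite ler_norml; apply/andP; clear - a1 e'1 tr2 da K2; split; lra.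
(* For a = 1 also d = 1, so b c = 0, although c <> 0 and |b| is large. *)
have a1' : 0 < a - 1.
  rewrite ltNge; apply/negP => a1'.
  have aE : a = 1 by clear - a1' da tr2; lra.
  have dE : d = 1 by clear - aE da tr2; lra.
  have /eqP : b * c = 0 by clear - det aE dE; move: det; rewrite aE dE; lra.
  rewrite mulf_eq0 (negbTE c0) orbF => /eqP b0.
  by move: bK; rewrite b0 normr0 ltNge; move/negP; apply; clear - K2; lra.
have [th trE] : exists th, a + d = 2 + th by exists (a + d - 2); ring.
have th0 : 0 <= th by clear - trE tr2; lra.
have [||j [xj uj]] := dense a th.
- by apply/andP; clear - a1' a1 e'eta; split; lra.
- by apply/andP; clear - th0 trE da; split; lra.
have [Aj0 Aj1] := SL2_powE j EA trE.
exists (A ^+ j)%g; split; [exact: power_closed|by rewrite Aj0|].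
have [_ u0] := chebyshev_ge j th0.
rewrite Aj1 normrM (ger0_norm u0).
have b0 : 0 < `|b| by clear - bK K2; lra.
have bT : 3 * T < e * `|b|.
  by apply: le_lt_trans KT _; rewrite ltr_pM2l.
rewrite -(ltr_pM2r b0); apply: le_lt_trans bT.
rewrite mulrAC -normrM (mulrC c).
have -> : b * c = a * d - 1 by rewrite -det; ring.
apply: (@le_trans _ _ (3 * (a - 1) * (chebyshev th j).2)); last first.
  by clear - uj; lra.
apply: ler_wpM2r => //; rewrite ler_norml.
clear - a1' da a1 e'1 tr2.
have ? : 0 <= (a - 1) * (a - d) by apply: mulr_ge0; lra.
have ? : 0 <= (a - 1) * (2 - a) by apply: mulr_ge0; lra.
by apply/andP; split; nra.
Qed.

(** The limit is the supremum of the numbers x such that upper left entries in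
    [x, B] occur together with arbitrarily small lower left entries. *)
Lemma axis_limit_of_bounded M B : M <= B ->
  (forall e, 0 < e -> exists A : SL2 R,
     [/\ L A, M <= val A 0 0 <= B & `|val A 1 0| < e]) ->
  exists2 T, M <= T & axis_limit T.
Proof.
move=> MB ex.
pose S : set R := [set x | forall e, 0 < e -> exists A : SL2 R,
     [/\ L A, x <= val A 0 0 <= B & `|val A 1 0| < e]].
have SM : S M by [].
have ubS : ubound S B.
  move=> x /(_ 1 ltr01) [A [_ /andP[xA AB] _]]; exact: le_trans xA AB.
have hS : has_sup S by split; [exists M|exists B].
have leS x : S x -> x <= sup S by move=> Sx; apply: ub_le_sup => //; exists B.
exists (sup S); first exact: leS.
move=> e e0.
have [x Sx xe] := sup_adherent e0 hS.
have nS : ~ S (sup S + e / 2).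
  by move=> /leS; clear - e0; lra.
have [d d0 hd] : exists2 d, 0 < d & forall A : SL2 R, L A -> `|val A 1 0| < d ->
    val A 0 0 <= B -> val A 0 0 < sup S + e / 2.
  apply: contrapT => h; apply: nS => d d0; apply: contrapT => h'; apply: h.
  exists d => // A LA cd AB; rewrite ltNge; apply/negP => Ae; apply: h'.
  by exists A; split => //; apply/andP.
have de0 : 0 < Num.min d e by rewrite lt_min d0.
have [A [LA /andP[xA AB]]] := Sx _ de0; rewrite lt_min => /andP[cd ce].
have Ae := hd _ LA cd AB; exists A; split => //.
by rewrite ltr_norml; apply/andP; clear - xe xA Ae e0; split; lra.
Qed.

(** The exponent k is chosen from eta and M alone, so the entries of A^k are
    bounded uniformly in A and its lower left entry is at most a constant
    multiple of that of A. *)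
Lemma axis_limit_far_id K eta : 0 < eta ->
  (forall e, 0 < e -> exists A : SL2 R, [/\ L A, `|val A 1 0| < e,
     2 <= val A 0 0 + val A 1 1 & val A 1 1 <= val A 0 0] /\
     1 + eta <= val A 0 0 <= K) ->
  forall M, exists2 T, M <= T & axis_limit T.
Proof.
move=> eta0 ex M.
pose M' := Num.max 1 M; have M1 : 1 <= M' by rewrite le_max lexx.
have K1 : 1 + eta <= K.
  by have [A [_ /andP[]]] := ex 1 ltr01; exact: le_trans.
have k0 : 0 <= M' / eta by apply: divr_ge0; lra.
have := archi_boundP k0; set k := Num.bound _; rewrite ltr_pdivrMr // => hk.
(* The trace a + d is at most 2 K, so that th <= th'. *)
pose th' := 2 * K.
pose u' := (chebyshev th' k).2; pose B := (chebyshev th' k).1 + K * u'.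
have th'0 : 0 <= th' by rewrite /th'; lra.
have [v'1 u'0] := chebyshev_ge k th'0.
have powB A : L A -> 2 <= val A 0 0 + val A 1 1 -> val A 1 1 <= val A 0 0 ->
    1 + eta <= val A 0 0 <= K ->
  [/\ L (A ^+ k)%g, M' <= val (A ^+ k)%g 0 0 <= B &
      `|val (A ^+ k)%g 1 0| <= `|val A 1 0| * u'].
  have [a [b [c [d [EA _]]]]] := SL2_entries A.
  rewrite EA !mx2E => LA tr da /andP[aeta aK].
  have [th trE] : exists th, a + d = 2 + th by exists (a + d - 2); ring.
  have th0 : 0 <= th by clear - trE tr; lra.
  have [Ak0 Ak1] := SL2_powE k EA trE.
  have [|hv hu] := @chebyshev_mono _ th th' k.
    by apply/andP; split => //; clear - trE da aK; rewrite /th'; lra.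
  have [v1 u0] := chebyshev_ge k th0.
  split; first exact: power_closed.
    rewrite Ak0; apply/andP; split.
      apply: le_trans (power_corner_ge k th0 _); last by clear - eta0 aeta; lra.
      have : k%:R * eta <= k%:R * (a - 1).
        by apply: ler_wpM2l; rewrite ?ler0n //; clear - aeta; lra.
      by clear - hk; lra.
    rewrite /power_corner /B; apply: lerD => //.
    by apply: ler_pM => //; clear - aeta aK eta0; lra.
  by rewrite Ak1 normrM (ger0_norm u0); exact: ler_wpM2l.
have [|e e0|T MT] := @axis_limit_of_bounded M' B.
- have [A [[LA _ tr da] aK]] := ex 1 ltr01.
  by have [_ /andP[] + + _] := powB A LA tr da aK; exact: le_trans.
- have [A [[LA ce tr da] aK]] :=
    ex (e / (u' + 1)) (divr_gt0 e0 (ltr_wpDl u'0 ltr01)).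
  exists (A ^+ k)%g; have [? ? h] := powB A LA tr da aK; split => //.
  apply: le_lt_trans h _.
  move: ce; rewrite ltr_pdivlMr; last by lra.
  by apply: le_lt_trans; apply: ler_wpM2l => //; lra.
- by exists T => //; apply: le_trans MT; rewrite le_max lexx orbT.
Qed.

Lemma axis_limit_unbounded K : bottom_left_isolated ->
  (forall e, 0 < e -> exists A : SL2 R,
    [/\ L A, val A 1 0 != 0, `|val A 1 0| < e,
     2 <= val A 0 0 + val A 1 1 & val A 1 1 <= val A 0 0 <= K]) ->
  forall M, exists2 T, M <= T & axis_limit T.
Proof.
move=> disc ex.
have [near1|] := pselect (forall e, 0 < e ->
  exists A : SL2 R, [/\ L A, val A 1 0 != 0, `|val A 1 0| < e,
     2 <= val A 0 0 + val A 1 1 & val A 1 1 <= val A 0 0 < 1 + e]).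
  move=> M; exists (Num.max 1 M); first by rewrite le_max lexx orbT.
  by apply: axis_limit_near_id => //; rewrite le_max lexx.
move=> /existsNP[eta /not_implyP[eta0 far]].
apply: (@axis_limit_far_id K eta) => // e e0.
have ee0 : 0 < Num.min e eta by rewrite lt_min e0.
have [A [LA c0]] := ex _ ee0; rewrite lt_min => /andP[ce ceta] tr /andP[da aK].
exists A; split => //; rewrite aK andbT leNgt; apply/negP => ae; apply: far.
by exists A; split => //; rewrite da.
Qed.

End AxisLimits.

(** * The group seen from the frame of a vector *)
Section Framed.
Variables (R : realType) (G : fuchsian R) (w : T1H2 R).
Implicit Types (A B : SL2 R).

Definition framed : set (SL2 R) :=
  [set A | G (\pi_(PSL2 R) (frame w * A * (frame w)^-1)%g)].

Lemma pi_conj_id A : \pi_(PSL2 R) (frame w * A * (frame w)^-1)%g = 1%g ->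
  \pi_(PSL2 R) A = 1%g.
Proof.
rewrite !piM piV => e; apply: (mulgI (\pi_(PSL2 R) (frame w))).
by apply: (mulIg (\pi_(PSL2 R) (frame w))^-1%g); rewrite e mulg1 mulgV.
Qed.

Lemma framed1 : framed 1%g.
Proof. by rewrite /framed /= mulg1 mulgV; exact: fuchsian1. Qed.

Lemma framedM A B : framed A -> framed B -> framed (A * B)%g.
Proof.
move=> GA GB; rewrite /framed /=.
have -> : (frame w * (A * B) * (frame w)^-1 =
  (frame w * A * (frame w)^-1) * (frame w * B * (frame w)^-1))%g.
  by rewrite !mulgA mulgVK.
by rewrite piM; exact: fuchsianM.
Qed.

Lemma framedV A : framed A -> framed A^-1%g.
Proof.
move=> GA; rewrite /framed /=.
have -> : (frame w * A^-1 * (frame w)^-1 = (frame w * A * (frame w)^-1)^-1)%g.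
  by rewrite !invgM invgK mulgA.
by rewrite piV; exact: fuchsianV.
Qed.

Lemma framed_opp A : framed A -> framed (SL2_opp A).
Proof.
rewrite /framed /=; suff -> : (frame w * SL2_opp A * (frame w)^-1)%g =
  SL2_opp (frame w * A * (frame w)^-1)%g by rewrite pi_SL2_opp.
by apply: val_inj; rewrite /= mulmxN mulNmx.
Qed.

Lemma pi_framed A z : framed A ->
  \pi_(T1S G) (SL2_actT (frame w * A)%g z) = \pi_(T1S G) (SL2_actT (frame w) z).
Proof.
move=> GA; apply/esym/T1S_eqP/asboolP.
exists (\pi_(PSL2 R) (frame w * A * (frame w)^-1)%g) => //.
by rewrite PSL2_actT_pi -SL2_actTM mulgVK.
Qed.

Lemma pi_framedH A z : framed A ->
  \pi_(surface G) (SL2_actH (frame w * A)%g z) =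
  \pi_(surface G) (SL2_actH (frame w) z).
Proof.
move=> GA; apply/esym/surface_eqP/asboolP.
exists (\pi_(PSL2 R) (frame w * A * (frame w)^-1)%g) => //.
by rewrite PSL2_actH_pi -SL2_actHM mulgVK.
Qed.

End Framed.

(** * Horocycle orbit closures and limits of first columns *)
Section Flows.
Variable R : realType.
Implicit Types (A B : SL2 R).

Lemma unip_det (s : R) : \det (mx2 1 s 0 1) = 1.
Proof. by rewrite det_mx2; ring. Qed.
Definition unip s : SL2 R := mkSL2 (unip_det s).

(** The image of the vector (i, i) under a matrix of determinant 1, in real
    coordinates: the base point is (a i + b) / (c i + d) and the vector is
    i / (c i + d)^2. *)
Definition act_i (M : 'M[R]_2) : (R * R) * (R * R) :=
  let n := M 1 0 ^+ 2 + M 1 1 ^+ 2 in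
  (((M 0 1 * M 1 1 + M 0 0 * M 1 0) / n, n^-1),
   (2 * M 1 0 * M 1 1 / n ^+ 2, (M 1 1 ^+ 2 - M 1 0 ^+ 2) / n ^+ 2)).

Lemma bottom_row_gt0 A : 0 < val A 1 0 ^+ 2 + val A 1 1 ^+ 2.
Proof.
have := SL2_detE A; rewrite lt0r addr_ge0 ?sqr_ge0 // andbT.
rewrite paddr_eq0 ?sqr_ge0 // !sqrf_eq0 => det.
by apply/negP => /andP[/eqP c0 /eqP d0]; move: det; rewrite c0 d0 !mulr0 subr0
  => /esym/eqP; rewrite oner_eq0.
Qed.

Lemma val_actT_horizontal A : val (SL2_actT A (horizontal 0)) = act_i (val A).
Proof.
have n0 := bottom_row_gt0 A; have det := SL2_detE A.
rewrite /= /act_i /mobius /mobius_deriv /mob_den SL2_det.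
move: n0 det; move: (val A 0 0) (val A 0 1) (val A 1 0) (val A 1 1) => a b c d.
move=> n0 det; rewrite /uncplx /cplx /=.
have -> : c * 0 - 0 * 1 + d = d by ring.
have -> : c * 1 + 0 * 0 + 0 = c by ring.
have -> : (d * d - c * c) ^+ 2 + (d * c + c * d) ^+ 2 = (c ^+ 2 + d ^+ 2) ^+ 2.
  by ring.
have nE : (c ^+ 2 + d ^+ 2)^-1 = (a * d - b * c) / (c ^+ 2 + d ^+ 2).
  by rewrite det mul1r.
rewrite (addrC (d ^+ 2)) [X in _ = (_, X, _)]nE.
by congr (_, _, (_, _)); field; rewrite gt_eqF.
Qed.

Lemma actT_unip s : SL2_actT (unip s) (horizontal 0) = horizontal s.
Proof.
apply: val_inj; rewrite val_actT_horizontal /act_i /= !mx2E.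
rewrite expr0n expr1n add0r !mulr0 mul0r addr0 subr0.
by rewrite !(invr1, expr1n, mulr1).
Qed.

Lemma vertical_det (y : R) : 0 < y -> \det (mx2 y 0 0 y^-1) = 1.
Proof. by move=> y0; rewrite det_mx2 mulr0 subr0 divff // gt_eqF. Qed.

Lemma val_vertical y : 0 < y ->
  val (vertical (2 * ln y)) = act_i (mx2 y 0 0 y^-1).
Proof.
move=> y0; rewrite /act_i /= !mx2E mulrC expRM_natr lnK ?posrE //.
by congr (_, _, (_, _)); field; rewrite gt_eqF.
Qed.

Lemma act_i_cvg (T : topologicalType) (F : set_system T) (f : T -> 'M[R]_2)
    (M : 'M[R]_2) :
  Filter F -> M 1 0 ^+ 2 + M 1 1 ^+ 2 != 0 ->
  (forall i j, f x i j @[x --> F] --> M i j) ->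
  act_i (f x) @[x --> F] --> act_i M.
Proof.
move=> FF n0 fM.
have n_cvg : (f x 1 0) ^+ 2 + (f x 1 1) ^+ 2 @[x --> F] -->
    M 1 0 ^+ 2 + M 1 1 ^+ 2 by apply: cvgD; exact: cvgM.
have n2_cvg : ((f x 1 0) ^+ 2 + (f x 1 1) ^+ 2) ^+ 2 @[x --> F] -->
    (M 1 0 ^+ 2 + M 1 1 ^+ 2) ^+ 2 by exact: cvgM.
have n20 : (M 1 0 ^+ 2 + M 1 1 ^+ 2) ^+ 2 != 0 by rewrite expf_neq0.
have pair_cvg (U V : topologicalType) (g : T -> U) (h : T -> V)
    (y : U) (z : V) :
    g @ F --> y -> h @ F --> z -> (g x, h x) @[x --> F] --> (y, z).
  by move=> gy hz; exact: cvg_pair.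
apply: (@pair_cvg (R * R)%type (R * R)%type (fun x => (act_i (f x)).1)
  (fun x => (act_i (f x)).2) (act_i M).1 (act_i M).2).
  apply: (@pair_cvg R R); last exact: cvgV.
  by apply: cvgM; [apply: cvgD; exact: cvgM|exact: cvgV].
apply: (@pair_cvg R R); apply: cvgM; try exact: cvgV.
  by apply: cvgM => //; apply: cvgM => //; exact: cvg_cst.
by apply: cvgB; exact: cvgM.
Qed.

End Flows.

Lemma nbhs_set_type (T : topologicalType) (S : set T) (z : set_type S)
    (V : set (set_type S)) : nbhs z V ->
  exists2 O : set T, nbhs (val z : T) O & forall z', O (val z') -> V z'.
Proof.
rewrite !nbhsE => -[U [[O oO OU] Uz] UV]; rewrite -OU in Uz UV.
by exists O; [exists O|move=> z' Oz'; exact: UV].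
Qed.

Section Closure.
Variables (R : realType) (G : fuchsian R) (w : T1H2 R).

(** For s = - b / a the matrix A n_s, with n_s the upper unipotent matrix of
    parameter s, is [a 0; c 1/a], which is close to diag(T, 1/T), the matrix of
    g_(2 ln T), when (a, c) is close to (T, 0). *)
Lemma axis_limit_closure (T : R) : 0 < T -> axis_limit (framed G w) T ->
  closure (horocycle_orbit (\pi_(T1S G) w))
    (geodesic_flowS (2 * ln T) (\pi_(T1S G) w)).
Proof.
move=> T0 lim; rewrite geodesic_flowS_pi => V.
move=> /(@pi_continuous _ _ (geodesic_flow (2 * ln T) w)).
move=> /nbhs_set_type[O nO OV].
pose f (x : R * R) := val (frame w) *m mx2 x.1 0 x.2 x.1^-1.
have valE A x : val A = mx2 x.1 0 x.2 x.1^-1 ->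
    val (SL2_actT (frame w * A)%g (horizontal 0)) = act_i (f x).
  by move=> EA; rewrite val_actT_horizontal /= EA.
have geoE : val (geodesic_flow (2 * ln T) w) = act_i (f (T, 0)).
  rewrite -(valE (mkSL2 (vertical_det T0))) // SL2_actTM.
  congr (val (SL2_actT _ _)).
  by apply: val_inj; rewrite val_actT_horizontal val_vertical.
have fcvg : act_i (f x) @[x --> (T, 0 : R)] --> act_i (f (T, 0)).
  apply: act_i_cvg.
    have := bottom_row_gt0 (frame w * mkSL2 (vertical_det T0))%g.
    by rewrite lt0r => /andP[].
  move=> i j; rewrite mulmx2E; under eq_cvg do rewrite mulmx2E.
  have cvg1 : x.1 @[x --> (T, 0 : R)] --> T by exact: cvg_fst.
  have cvg2 : x.2 @[x --> (T, 0 : R)] --> (0 : R) by exact: cvg_snd.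
  apply: cvgD; apply: cvgM; try exact: cvg_cst.
    by elim/ord2P: j; rewrite mx2E; under eq_cvg do rewrite mx2E;
      [|exact: cvg_cst].
  elim/ord2P: j; rewrite mx2E; under eq_cvg do rewrite mx2E.
    exact: cvg2.
  by apply: (cvgV _ cvg1); rewrite gt_eqF.
have := fcvg O; rewrite -geoE => /(_ nO) [[P Q] [/= nP nQ] PQ].
have /nbhs_ballP[e /= e0 hP] := nP; have /nbhs_ballP[e' /= e'0 hQ] := nQ.
have ee0 : 0 < Num.min T (Num.min e e') by rewrite !lt_min T0 e0.
have [A [LA]] := lim _ ee0.
have [a [b [c [d [EA det]]]]] := SL2_entries A.
rewrite EA !mx2E !lt_min => /and3P[aT ae _] /and3P[_ _ ce'].
have a0 : a != 0.
  by apply/eqP => a0; move: aT; rewrite a0 sub0r normrN gtr0_norm // ltxx.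
exists (horocycle_flowS (- b / a) (\pi_(T1S G) w)); split.
  by exists (- b / a).
rewrite horocycle_flowS_pi -(@pi_framed _ _ _ A) //.
rewrite -actT_unip -SL2_actTM -mulgA.
apply: OV; rewrite (valE _ (a, c)).
  apply: PQ; split; [apply: hP|apply: hQ]; rewrite /ball /= distrC //.
  by rewrite subr0.
apply: mx2_ext; rewrite /= mulmx2E EA !mx2E; first by ring.
- by field.
- by ring.
by transitivity ((a * d - b * c) / a); [field|rewrite det mul1r].
Qed.

End Closure.

(** * Displacement of points of the axis *)
Section Distance.
Variable R : realType.
Implicit Types (A B : SL2 R) (x y t : R).

Definition axis t : H2 R := basept (vertical t).

Lemma expR_acosh x : 1 <= x -> x <= expR (acosh x) <= 2 * x.
Proof.
move=> x1; have s0 := sqrtr_ge0 (x ^+ 2 - 1).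
have xx : 1 <= x ^+ 2 by rewrite expr_ge1 //; lra.
have sx : Num.sqrt (x ^+ 2 - 1) <= x.
  by rewrite -(ler_pXn2r (n := 2)) ?nnegrE ?sqr_sqrtr //; lra.
rewrite /acosh lnK ?posrE; last by lra.
by apply/andP; split; lra.
Qed.

Lemma acosh_ge0 x : 1 <= x -> 0 <= acosh x.
Proof. by move=> x1; rewrite -ler_expR expR0; have := expR_acosh x1; lra. Qed.

(** This is cosh d(ix, M iy) - 1 for M of determinant 1, see [dist_axis]. *)
Definition displacement (M : 'M[R]_2) (x y : R) : R :=
  ((M 1 0 * x * y + M 0 1) ^+ 2 + (M 1 1 * x - M 0 0 * y) ^+ 2) / (2 * x * y).

Lemma displacement_ge0 M x y : 0 < x -> 0 < y -> 0 <= displacement M x y.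
Proof.
move=> x0 y0; apply: divr_ge0; first by rewrite addr_ge0 ?sqr_ge0.
by rewrite !mulr_ge0 // ltW.
Qed.

Lemma dist_axis A s t : dist_H2 (axis s) (SL2_actH A (axis t)) =
  acosh (1 + displacement (val A) (expR s) (expR t)).
Proof.
have x0 := expR_gt0 s; have y0 := expR_gt0 t.
have den0 := mob_den_SL2 A (axis t).
have n0 := nsq_gt0 den0.
rewrite /dist_H2; congr (acosh (1 + _)).
have -> : (val (SL2_actH A (axis t))).2 =
    expR t / nsq (mob_den (val A) (cplx (val (axis t)))).
  rewrite -[LHS]/(complex.Im _) Im_mobius //; exact: SL2_det.
have -> : cplx (val (axis s)) - cplx (val (SL2_actH A (axis t))) =
    (cplx (val (axis s)) * mob_den (val A) (cplx (val (axis t))) -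
      ((val A 0 0)%:C * cplx (val (axis t)) + (val A 0 1)%:C)%C) /
    mob_den (val A) (cplx (val (axis t))).
  by rewrite [cplx (val (SL2_actH _ _))]uncplxK /mobius mulrBl mulfK.
rewrite nsqM nsqV /displacement.
have [a [b [c [d [EA _]]]]] := SL2_entries A.
move: n0; rewrite /nsq /mob_den EA !mx2E /= => n0.
move: x0 y0 n0; move: (expR s) (expR t) => x y x0 y0.
rewrite mulr0 mul0r subr0 add0r mulr0 !addr0 addrC => n0.
by field; rewrite !gt_eqF.
Qed.

End Distance.

(** * Almost minimizing rays *)
Section Geometry.
Variables (R : realType) (G : fuchsian R) (w : T1H2 R).
Implicit Types (A B : SL2 R).
Local Notation F := (frame w).
Local Notation L := (framed G w).

Lemma basept_axis : basept w = SL2_actH F (axis 0).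
Proof. by rewrite -{1}(frameP w) basept_act /axis vertical0. Qed.

(** The hypothesis bounds exp d(i, A iy) from below by exp(-C) y, while it is at
    most 2 cosh d(i, A iy) = y (a^2 + c^2 + (b^2 + d^2) / y^2); letting y go to
    infinity gives the bound exp(-C).  Geometrically, ln (a^2 + c^2) is the
    Busemann function of the ray at the point A^-1 i. *)
Lemma almost_minimizing_ge : almost_minimizing (\pi_(T1S G) w) ->
  exists2 r : R, 0 < r & forall A, L A -> r <= val A 0 0 ^+ 2 + val A 1 0 ^+ 2.
Proof.
move=> [C C0 amin]; exists (expR (- C)); first exact: expR_gt0.
move=> A LA; have [a [b [c [d [EA det]]]]] := SL2_entries A.
rewrite EA !mx2E.
have key y : 1 < y -> expR (- C) < a ^+ 2 + c ^+ 2 + (b ^+ 2 + d ^+ 2) / y ^+ 2.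
  move=> y1; have y0 : 0 < y by lra.
  have : ln y - C < acosh (1 + displacement (val A) 1 y).
    apply: lt_le_trans (amin _ (ln_gt0 y1)) _.
    have -> : acosh (1 + displacement (val A) 1 y) =
        dist_H2 (SL2_actH F (axis 0)) (SL2_actH F (SL2_actH A (axis (ln y)))).
      by rewrite dist_H2_act dist_axis expR0 lnK.
    rewrite -basept_axis -SL2_actHM geodesic_flowS_pi !baseptS_pi.
    apply: ge_inf.
      exists 0 => _ [z [z' [_ _ ->]]]; apply: acosh_ge0.
      rewrite lerDl divr_ge0 //.
        by rewrite /nsq addr_ge0 ?sqr_ge0.
      by rewrite !mulr_ge0 // ltW // H2_gt0.
    exists (basept w), (SL2_actH (F * A)%g (axis (ln y))); split => //.
    by rewrite (pi_framedH _ LA) /geodesic_flow basept_act.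
  move=> h.
  have {}h : y * expR (- C) < expR (acosh (1 + displacement (val A) 1 y)).
    by rewrite -[X in X * _](lnK y0) -expRD ltr_expR.
  have /expR_acosh/andP[_ h'] : 1 <= 1 + displacement (val A) 1 y.
    by rewrite lerDl displacement_ge0.
  move: (lt_le_trans h h').
  have -> : 2 * (1 + displacement (val A) 1 y) =
    y * (a ^+ 2 + c ^+ 2 + (b ^+ 2 + d ^+ 2) / y ^+ 2).
    rewrite /displacement EA !mx2E -[X in _ * (X + _)]det; field.
    by rewrite gt_eqF.
  by rewrite ltr_pM2l.
rewrite leNgt; apply/negP => lt.
pose e := expR (- C) - (a ^+ 2 + c ^+ 2).
have e0 : 0 < e by rewrite /e; lra.
pose q := b ^+ 2 + d ^+ 2; have q0 : 0 <= q by rewrite addr_ge0 ?sqr_ge0.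
have y1 : 1 < q / e + 2 by have := divr_ge0 q0 (ltW e0); lra.
have := key _ y1; rewrite -/q.
have : q / (q / e + 2) ^+ 2 <= e.
  rewrite ler_pdivrMr ?exprn_gt0 //; last by lra.
  have -> : e * (q / e + 2) ^+ 2 = q + (q * (q / e) + 3 * q + 4 * e).
    by field; rewrite gt_eqF.
  by rewrite lerDl; have := mulr_ge0 q0 (divr_ge0 q0 (ltW e0)); lra.
by rewrite /e; lra.
Qed.

End Geometry.

(** * Stabilizer of the endpoint and traces *)
Section Stabilizer.
Variables (R : realType) (G : fuchsian R) (w : T1H2 R).
Implicit Types (A B : SL2 R).
Local Notation F := (frame w).
Local Notation L := (framed G w).

Lemma diag_contracting A r : val A 1 0 = 0 -> `|val A 0 0| < 1 -> 0 < r ->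
  exists n, val (A ^+ n)%g 1 0 = 0 /\ val (A ^+ n)%g 0 0 ^+ 2 < r.
Proof.
have [a [b [c [d [EA det]]]]] := SL2_entries A.
rewrite EA !mx2E => c0 a1 r0.
have powA n : val (A ^+ n)%g 1 0 = 0 /\ val (A ^+ n)%g 0 0 = a ^+ n.
  elim: n => [|n [IH0 IH1]]; first by rewrite expg0 /= !mxE.
  rewrite expgS /= !mulmx2E IH0 IH1 EA !mx2E c0 !mulr0 mul0r !addr0.
  by rewrite exprS.
have aa1 : `|a ^+ 2| < 1.
  by rewrite normrX expr_lt1.
have /cvgr0_norm_lt/(_ r r0)[n _ /(_ n (leqnn n)) /= an] := cvg_expr aa1.
exists n; have [-> ->] := powA n; split => //.
by rewrite exprAC; apply: le_lt_trans an; exact: ler_norm.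
Qed.

(** If |a| <> 1, a power of A or of A^-1 contradicts [almost_minimizing_ge];
    if |a| = 1, then A is plus or minus the unipotent matrix of some parameter
    b, and if b <> 0, then |b| is a period of the horocycle flow. *)
Lemma stab_infty_trivial A : almost_minimizing (\pi_(T1S G) w) ->
  ~ horocycle_periodic (\pi_(T1S G) w) -> L A -> val A 1 0 = 0 ->
  \pi_(PSL2 R) A = 1%g.
Proof.
move=> /almost_minimizing_ge[r r0 amin] nper.
have unip_periodic s : 0 < s -> ~ L (unip s).
  move=> s0 Ls; apply: nper; exists s => //.
  rewrite horocycle_flowS_pi /horocycle_flow -actT_unip -SL2_actTM pi_framed //.
  by rewrite frameP.
have ge1 B : L B -> val B 1 0 = 0 -> 1 <= `|val B 0 0|.
  move=> LB c0; rewrite leNgt; apply/negP => a1.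
  have [n [cn an]] := diag_contracting c0 a1 r0.
  have := amin _ (power_closed (framed1 G w) (@framedM _ G w) n LB).
  by rewrite cn expr0n addr0 leNgt an.
have one_ge0 B : L B -> val B 1 0 = 0 -> 0 <= val B 0 0 -> \pi_(PSL2 R) B = 1%g.
  move=> LB c0 a0; have [a [b [c [d [EB det]]]]] := SL2_entries B.
  have := ge1 _ LB c0; have := ge1 _ (framedV LB).
  rewrite SL2_invE; move: c0 a0; rewrite EB !mx2E => c0 a0.
  rewrite c0 oppr0 (ger0_norm a0) => /(_ erefl) d1 a1.
  have adE : a * d = 1 by rewrite -det c0; ring.
  have d0 : 0 < d by rewrite -(pmulr_rgt0 d (_ : 0 < a)) ?adE //; lra.
  rewrite gtr0_norm // in d1.
  have aE : a = 1.
    apply/eqP; rewrite eq_le a1 andbT -adE; apply: ler_peMr => //.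
  have dE : d = 1 by move: adE; rewrite aE mul1r.
  have [b0|b0|b0] := ltgtP b 0.
  - case: (unip_periodic (- b)); first by rewrite oppr_gt0.
    suff <- : B^-1%g = unip (- b) by exact: framedV.
    by apply: val_inj; rewrite SL2_invE EB !mx2E aE dE c0 oppr0.
  - case: (unip_periodic b) => //; suff <- : B = unip b by [].
    by apply: val_inj; rewrite EB aE dE c0.
  - suff -> : B = 1%g by [].
    apply: val_inj; rewrite EB aE dE c0 b0.
    by apply: mx2_ext; rewrite mx2E !mxE.
move=> LA c0; have [a0|a0] := leP 0 (val A 0 0); first exact: one_ge0.
rewrite -pi_SL2_opp; apply: one_ge0; first exact: framed_opp.
  by rewrite /= mxE c0 oppr0.
by rewrite /= mxE oppr_ge0 ltW.
Qed.

(** If |a + d| < 2, the fixed point equation c z^2 + (d - a) z - b = 0 has the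
    discriminant (a + d)^2 - 4 < 0, hence a root in the upper half-plane. *)
Lemma trace_ge2 A : (forall g : PSL2 R, G g -> ~ elliptic g) ->
  L A -> val A 1 0 != 0 -> 2 <= `|val A 0 0 + val A 1 1|.
Proof.
move=> noell.
have wlog_pos B : L B -> 0 < val B 1 0 -> 2 <= `|val B 0 0 + val B 1 1|.
  have [a [b [c [d [EB det]]]]] := SL2_entries B.
  rewrite EB !mx2E => LB c0; rewrite leNgt; apply/negP => tr.
  have tr4 : 0 < 4 - (a + d) ^+ 2.
    rewrite subr_gt0 -real_normK ?num_real // (_ : 4 = 2 ^+ 2); last by ring.
    by rewrite ltr_pXn2r ?nnegrE.
  pose s : R := Num.sqrt (4 - (a + d) ^+ 2).
  have s0 : 0 < s by rewrite sqrtr_gt0.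
  have sE : s ^+ 2 = 4 - (a + d) ^+ 2 by rewrite sqr_sqrtr // ltW.
  have hz : half_plane ((a - d) / (2 * c), s / (2 * c)).
    by rewrite /half_plane /= divr_gt0 // mulr_gt0.
  apply: (noell _ LB); split.
    move=> /pi_conj_id/pi_SL2_id_bottom_left; rewrite EB mx2E => e.
    by rewrite e ltxx in c0.
  exists (SL2_actH F (mkH2 hz)).
  rewrite PSL2_actH_pi -SL2_actHM mulgVK SL2_actHM; congr SL2_actH.
  have den0 := mob_den_SL2 B (mkH2 hz).
  apply: val_inj; apply: (can_inj (@cplxK R)); rewrite [LHS]uncplxK.
  apply: (mulIf den0); rewrite /mobius divfK //.
  rewrite /mob_den EB !mx2E /cplx /=; apply/eqP; rewrite eq_complex /=.
  apply/andP; split; apply/eqP; last by field; rewrite gt_eqF.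
  have -> : s / (2 * c) *
      (c * (s / (2 * c)) + 0 * ((a - d) / (2 * c)) + 0) = s ^+ 2 / (4 * c).
    by field; rewrite gt_eqF.
  rewrite sE (_ : b = (a * d - 1) / c).
    by field; rewrite gt_eqF.
  by rewrite -det; field; rewrite gt_eqF.
move=> LA; rewrite neq_lt => /orP[c0|]; last exact: wlog_pos.
have := wlog_pos _ (framed_opp LA); rewrite /= !mxE oppr_gt0 => /(_ c0).
by rewrite -opprD normrN.
Qed.

End Stabilizer.

(** * Discreteness *)
Section Discreteness.
Variables (R : realType) (G : fuchsian R) (w : T1H2 R).
Implicit Types (A B : SL2 R).
Local Notation F := (frame w).
Local Notation L := (framed G w).

Lemma mulmx2_cvg (T : Type) (E : set_system T) (f : T -> 'M[R]_2)
    (M P Q : 'M[R]_2) i j :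
  Filter E -> (forall k l, f x k l @[x --> E] --> M k l) ->
  (P *m f x *m Q) i j @[x --> E] --> (P *m M *m Q) i j.
Proof.
move=> FE fM; rewrite !mulmx2E; under eq_cvg do rewrite !mulmx2E.
by apply: cvgD; apply: cvgM; try exact: cvg_cst;
  apply: cvgD; apply: cvgM; try exact: cvg_cst; exact: fM.
Qed.

Lemma framed_isolated : exists2 eta : R, 0 < eta &
  forall A, L A -> (forall i j, `|val A i j - (1%:M : 'M[R]_2) i j| < eta) ->
  \pi_(PSL2 R) (F * A * F^-1)%g = 1%g.
Proof.
have [_ [V nV VE]] := fuchsian_discrete (fuchsian1 G).
have [O nO OV] := nbhs_set_type (@pi_continuous _ _ (1%g : SL2 R) V nV).
pose f (M : 'M[R]_2) := val F *m M *m val F^-1%g.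
have f1 : f 1%:M = 1%:M.
  by rewrite /f mulmx1; exact: (congr1 val (mulgV F)).
have fcvg i j : f M i j @[M --> (1%:M : 'M[R]_2)] --> (1%:M : 'M[R]_2) i j.
  have -> : (1%:M : 'M[R]_2) i j = f 1%:M i j by rewrite f1.
  have FF : Filter (nbhs (1%:M : 'M[R]_2)) by exact: nbhs_filter.
  by apply: (@mulmx2_cvg _ _ id _ _ _ i j FF) => k l; exact: coord_continuous.
have [P nP PO] := nO.
have [e e0 eO] : exists2 e : R, 0 < e & forall M : 'M[R]_2,
    (forall i j, `|M i j - (1%:M : 'M[R]_2) i j| < e) -> O (f M).
  have /nbhs_ballP[e /= e0 he] : nbhs (1%:M : 'M[R]_2) (f @^-1` O).
    have : \forall M \near (1%:M : 'M[R]_2), forall i j, P i j (f M i j).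
      have h i j : \forall M \near (1%:M : 'M[R]_2), P i j (f M i j).
        exact: (fcvg i j _ (nP i j)).
      apply: filterS (filterI (filterI (h 0 0) (h 0 1))
        (filterI (h 1 0) (h 1 1))).
      by move=> M [[h00 h01] [h10 h11]] i j; elim/ord2P: i; elim/ord2P: j.
    by apply: filterS => M; exact: PO.
  exists e => // M hM; apply: he; split => // i j.
  by rewrite /ball /= distrC.
exists e => // A LA hA.
have : (V `&` (G : set (PSL2 R))) (\pi_(PSL2 R) (F * A * F^-1)%g).
  by split => //; apply: OV; exact: eO.
by rewrite VE.
Qed.

(** The four conclusions are the entries of A^-1 A' - 1 = A^-1 (A' - A). *)
Lemma inv_mul_near_id (a b c d a' b' c' d' K h : R) : 0 < h ->
  `|a| <= K -> `|b| <= K -> `|c| <= K -> `|d| <= K -> a * d - b * c = 1 ->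
  `|a' - a| < h -> `|b' - b| < h -> `|c' - c| < h -> `|d' - d| < h ->
  [/\ `|d * a' - b * c' - 1| <= 2 * K * h, `|d * b' - b * d'| <= 2 * K * h,
      `|a * c' - c * a'| <= 2 * K * h & `|a * d' - c * b' - 1| <= 2 * K * h].
Proof.
move=> h0 aK bK cK dK det ha hb hc hd.
have key x y u v : `|x| <= K -> `|y| <= K -> `|u| < h -> `|v| < h ->
    `|x * u - y * v| <= 2 * K * h.
  move=> xK yK uh vh; apply: le_trans (ler_normB _ _) _.
  rewrite !normrM.
  have h1 : `|x| * `|u| <= K * h by apply: ler_pM => //; exact: ltW.
  have h2 : `|y| * `|v| <= K * h by apply: ler_pM => //; exact: ltW.
  by clear - h1 h2; lra.
split.
- rewrite (_ : _ - _ = d * (a' - a) - b * (c' - c)); first exact: key.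
  by rewrite -[in LHS]det; ring.
- by rewrite (_ : _ - _ = d * (b' - b) - b * (d' - d)); [exact: key|ring].
- by rewrite (_ : _ - _ = a * (c' - c) - c * (a' - a)); [exact: key|ring].
- rewrite (_ : _ - _ = a * (d' - d) - c * (b' - b)); first exact: key.
  by rewrite -[in LHS]det; ring.
Qed.

Lemma bounded_triples_recur (K e : R) (f : nat -> R * R * R) : 0 < e ->
  (forall n, [/\ `|(f n).1.1| <= K, `|(f n).1.2| <= K & `|(f n).2| <= K]) ->
  exists p : R * R * R, forall N, exists2 n, (N <= n)%N &
    [/\ `|(f n).1.1 - p.1.1| < e, `|(f n).1.2 - p.1.2| < e
      & `|(f n).2 - p.2| < e].
Proof.
move=> e0 fK; pose I : set R := [set` `[- K, K]].
have cI : compact (I `*` I `*` I).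
  have c1 : compact I by exact: segment_compact.
  exact: compact_setX (compact_setX c1 c1) c1.
have [|p [_ clp]] := cI (f @ \oo) _.
  exists 0%N => // n _ /=; have [h1 h2 h3] := fK n.
  by rewrite /I /= !in_itv /= -!ler_norml.
exists p => N.
have nb : nbhs p [set q : R * R * R |
    [/\ `|q.1.1 - p.1.1| < e, `|q.1.2 - p.1.2| < e & `|q.2 - p.2| < e]].
  apply/nbhs_ballP; exists e => // q [[h1 h2] h3] /=.
  by rewrite !(distrC (_ q.1)) (distrC q.2).
have fN : (f @ \oo) (f @` [set n | (N <= n)%N]).
  by exists N => // n Nn; exists n.
have [_ [[n Nn <-] ?]] := clp _ _ fN nb.
by exists n.
Qed.

(** Otherwise there is a bounded sequence in L with nonzero lower left entries
    tending to 0.  By compactness it has two terms so close to each other that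
    they differ by a sign only, the second one being taken so late that its
    lower left entry is smaller than that of the first one: a contradiction. *)
Lemma framed_bottom_left_isolated : bottom_left_isolated L.
Proof.
move=> K; apply: contrapT => nex.
have {}nex n : exists A, [/\ L A, `|val A 0 0| <= K /\ `|val A 0 1| <= K,
    `|val A 1 1| <= K, `|val A 1 0| < n.+1%:R^-1 & val A 1 0 != 0].
  apply: contrapT => nA; apply: nex.
  exists n.+1%:R^-1; first by rewrite invr_gt0.
  move=> A LA aK bK dK cn; apply/eqP; apply: contrapT => /negP c0; apply: nA.
  by exists A.
have [s sP] := choice nex.
have [eta eta0 iso] := framed_isolated.
pose K' := Num.max 1 K.
have K'1 : 1 <= K' by rewrite le_max lexx.
pose h := eta / (4 * K').
have h0 : 0 < h by rewrite divr_gt0 // mulr_gt0 //; lra.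
have [p hp] : exists p : R * R * R, forall N, exists2 n, (N <= n)%N &
    [/\ `|val (s n) 0 0 - p.1.1| < h / 2, `|val (s n) 0 1 - p.1.2| < h / 2 &
        `|val (s n) 1 1 - p.2| < h / 2].
  apply: (@bounded_triples_recur K (h / 2)
    (fun n => (val (s n) 0 0, val (s n) 0 1, val (s n) 1 1))).
    by rewrite divr_gt0.
  by move=> n; have [_ [? ?] ? _ _] := sP n.
have small (x : R) : 0 < x -> exists N, forall n, (N <= n)%N -> n.+1%:R^-1 < x.
  move=> x0; exists (Num.bound x^-1) => n Nn.
  rewrite invf_plt ?posrE //; apply: lt_le_trans (archi_boundP _) _.
    by rewrite invr_ge0 ltW.
  by rewrite ler_nat; exact: leqW.
have [N hN] := small (h / 2) (divr_gt0 h0 (ltr0n _ 2)).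
have [n Nn [pa pb pd]] := hp N.
have [LA [aK bK] dK cn c0] := sP n.
have nc0 : 0 < `|val (s n) 1 0| by rewrite normr_gt0.
have [N' hN'] := small _ nc0.
have [m] := hp (maxn N N'); rewrite geq_max => /andP[Nm N'm] [pa' pb' pd'].
have [LA' _ _ cm _] := sP m.
have cmn := lt_trans cm (hN' m N'm).
have {}cn := lt_trans cn (hN n Nn); have {}cm := lt_trans cm (hN m Nm).
have LB : L ((s n)^-1 * s m)%g by apply: framedM => //; exact: framedV.
have close (x y z : R) : `|x - z| < h / 2 -> `|y - z| < h / 2 -> `|y - x| < h.
  move=> xz yz; rewrite (_ : y - x = (y - z) - (x - z)); last by ring.
  apply: le_lt_trans (ler_normB _ _) _; clear - xz yz; lra.
have KK' (x : R) : `|x| <= K -> `|x| <= K'.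
  by move=> xK; rewrite le_max xK orbT.
have cK : `|val (s n) 1 0| <= K'.
  apply: le_trans (ltW (lt_le_trans (_ : _ < n.+1%:R^-1) _)) K'1.
    by have [] := sP n.
  by rewrite invf_le1 ?ler1n.
have cc : `|val (s m) 1 0 - val (s n) 1 0| < h.
  by apply: (@close _ _ 0); rewrite subr0.
have [e00 e01 e10 e11] := inv_mul_near_id h0 (KK' _ aK) (KK' _ bK) cK (KK' _ dK)
  (SL2_detE (s n)) (close _ _ _ pa pa') (close _ _ _ pb pb') cc
  (close _ _ _ pd pd').
have Kh : 2 * K' * h < eta.
  have -> : 2 * K' * h = eta / 2.
    by rewrite /h; field; clear - K'1; lra.
  by clear - eta0; lra.
have : \pi_(PSL2 R) ((s n)^-1 * s m)%g = 1%g.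
  apply: pi_conj_id; apply: iso => // i j; apply: le_lt_trans Kh.
  rewrite [val _](_ : _ = val (s n)^-1%g *m val (s m)) // mulmx2E SL2_invE.
  by elim/ord2P: i; elim/ord2P: j; rewrite !mx2E mxE /= mulNr ?subr0
    ?(addrC (- (_ * _))).
rewrite piM piV => /(congr1 (fun g => \pi_(PSL2 R) (s n) * g)%g).
rewrite mulVKg mulg1 => /PSL2_eqP; rewrite /sign_rel.
have : `|val (s m) 1 0| != `|val (s n) 1 0| by rewrite lt_eqF.
by move=> /eqP ne /orP[]/eqP e; apply: ne; rewrite e // mxE normrN.
Qed.

End Discreteness.

(** * Short elements along the ray *)
Section ShortElements.
Variables (R : realType) (G : fuchsian R) (w : T1H2 R).
Implicit Types (A B : SL2 R).
Local Notation F := (frame w).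
Local Notation L := (framed G w).

Lemma liminf_Inj_short (m t0 : R) : (liminf_Inj (\pi_(T1S G) w) < m%:E)%E ->
  exists t A, [/\ t0 < t, L A, \pi_(PSL2 R) A <> 1%g &
    dist_H2 (axis t) (SL2_actH A (axis t)) < m].
Proof.
rewrite /liminf_Inj limf_einfE => hm.
set f := (fun t : R => _) in hm.
pose U : set R := [set t | t0 < t].
have : (ereal_inf (f @` U) < m%:E)%E.
  apply: le_lt_trans hm; apply: ereal_sup_ubound.
  by exists U => //; exists t0; split => //; exact: num_real.
move=> /ereal_inf_lt[_ [t t0t <-]].
rewrite /f geodesic_flowS_pi baseptS_pi Inj_pi.
move=> /ereal_inf_lt[_ [g [Gg g1] <-]]; rewrite lte_fin => dm.
pose A := (F^-1 * repr g * F)%g.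
have FA : (F * A * F^-1)%g = repr g.
  by rewrite /A !mulgA mulgV mul1g mulgK.
clearbody A; exists t, A; split => //.
- by rewrite /framed /= FA reprK.
- move=> A1; apply: g1; by rewrite -[LHS]reprK -FA !piM piV A1 mulg1 mulgV.
apply: le_lt_trans dm; rewrite /geodesic_flow basept_act -/(axis t).
rewrite /PSL2_actH -FA -(dist_H2_act F) -!SL2_actHM.
by rewrite mulgVK.
Qed.

Hypothesis noell : forall g : PSL2 R, G g -> ~ elliptic g.
Hypothesis amin : almost_minimizing (\pi_(T1S G) w).
Hypothesis nper : ~ horocycle_periodic (\pi_(T1S G) w).

(** The displacement of A at iy is also that of -A and of A^-1, which allows one
    to reach a + d >= 2 and a >= d.  Twice the displacement is
    (c y)^2 + (b / y)^2 + a^2 + d^2 - 2, and a + d >= 2 turns a^2 + d^2 - 2 into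
    an upper bound of (a - 1)^2 + (d - 1)^2. *)
Lemma short_normalize A y xi : 0 < y -> L A -> \pi_(PSL2 R) A <> 1%g ->
  displacement (val A) y y <= xi ->
  exists B, [/\ L B, val B 1 0 != 0, 2 <= val B 0 0 + val B 1 1,
    val B 1 1 <= val B 0 0 &
    (val B 0 0 - 1) ^+ 2 + (val B 1 1 - 1) ^+ 2 + (val B 1 0 * y) ^+ 2
      <= 2 * xi].
Proof.
move=> y0 LA A1 Axi.
have Ac0 : val A 1 0 != 0.
  by apply/eqP => c0; apply: A1; exact: stab_infty_trivial amin nper LA c0.
pose P B := [/\ L B, val B 1 0 != 0 & displacement (val B) y y <= xi].
have PA : P A by [].
have dispN (M : 'M[R]_2) : displacement (- M) y y = displacement M y y.
  by rewrite /displacement !mxE; congr (_ / _); ring.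
have [B [LB c0 Bxi] trB] : exists2 B, P B & 2 <= val B 0 0 + val B 1 1.
  have := trace_ge2 noell LA Ac0; rewrite ler_normr => /orP[tr|tr].
    by exists A.
  exists (SL2_opp A); last by rewrite /= !mxE -opprD.
  split; [exact: framed_opp|by rewrite /= mxE oppr_eq0|].
  by rewrite dispN.
have {A LA A1 Axi Ac0 PA} [B' [LB' c0' Bxi'] [trB' dB']] : exists2 B, P B &
    2 <= val B 0 0 + val B 1 1 /\ val B 1 1 <= val B 0 0.
  have [da|ad] := leP (val B 1 1) (val B 0 0); first by exists B.
  exists B^-1%g; last by rewrite SL2_invE !mx2E addrC (ltW ad).
  split; [exact: framedV|by rewrite SL2_invE mx2E oppr_eq0|].
  rewrite SL2_invE; apply: le_trans Bxi.
  rewrite le_eqVlt; apply/orP; left; apply/eqP.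
  by rewrite /displacement !mx2E; congr (_ / _); ring.
exists B'; split => //.
have [a [b [c [d [EB det]]]]] := SL2_entries B'.
move: trB' Bxi'; rewrite /displacement EB !mx2E => tr h.
set delta := (_ / _) in h; apply: le_trans (_ : 2 * delta <= _).
  have -> : 2 * delta =
    (c * y) ^+ 2 + (b / y) ^+ 2 + a ^+ 2 + d ^+ 2 - 2 * (a * d - b * c).
    by rewrite /delta; field; rewrite gt_eqF.
  rewrite det; have := sqr_ge0 (b / y); clear - tr.
  by move: ((b / y) ^+ 2) ((c * y) ^+ 2) => p q p0; rewrite !expr2; lra.
by rewrite ler_pM2l.
Qed.

Lemma liminf_Inj_normalized (m t0 : R) :
  (liminf_Inj (\pi_(T1S G) w) < m%:E)%E ->
  exists2 t, t0 < t & exists B,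
   [/\ L B, val B 1 0 != 0, 2 <= val B 0 0 + val B 1 1,
    val B 1 1 <= val B 0 0 &
    (val B 0 0 - 1) ^+ 2 + (val B 1 1 - 1) ^+ 2 + (val B 1 0 * expR t) ^+ 2
      <= 2 * (expR m - 1)].
Proof.
move=> /(liminf_Inj_short t0)[t [A [t0t LA A1]]]; rewrite dist_axis => dm.
exists t => //; apply: (@short_normalize A) => //; first exact: expR_gt0.
have /expR_acosh/andP[h _] : 1 <= 1 + displacement (val A) (expR t) (expR t).
  by rewrite lerDl displacement_ge0 // expR_gt0.
rewrite lerBrDl; apply: le_trans h _.
by rewrite ler_expR ltW.
Qed.

Lemma liminf_Inj_lty_limits : (liminf_Inj (\pi_(T1S G) w) < +oo)%E ->
  forall M, exists2 T, M <= T & axis_limit L T.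
Proof.
move=> hoo; have [m hm] : exists m : R, (liminf_Inj (\pi_(T1S G) w) < m%:E)%E.
  move: hoo; case: (liminf_Inj _) => [r _||_] //.
    by exists (r + 1); rewrite lte_fin ltrDl.
  by exists 0; rewrite ltNyr.
have [xi xi0 mxi] : exists2 xi : R, 0 <= xi & expR m - 1 <= xi.
  by exists (Num.max 0 (expR m - 1)); rewrite le_max lexx ?orbT.
apply: (@axis_limit_unbounded _ _ (framed1 G w) (@framedM _ G w) (2 + 2 * xi)).
  exact: framed_bottom_left_isolated.
move=> e e0; have q0 : 0 < (2 * xi + 1) / e.
  by rewrite divr_gt0 // ltr_wpDl // mulr_ge0.
(* At this height y, the bound (c y)^2 <= 2 xi forces |c| < e. *)
have [t t0t [B [LB c0 tr da]]] :=
  liminf_Inj_normalized (ln ((2 * xi + 1) / e)) hm.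
have yt : (2 * xi + 1) / e < expR t.
  by rewrite -(lnK (q0 : _ \in Num.pos)) ltr_expR.
move: c0 tr da => c0 tr da h; exists B; split => //.
  rewrite ltNge; apply/negP => ec.
  rewrite ltr_pdivrMr // in yt.
  have y0 := expR_gt0 t.
  have h1 : 2 * xi + 1 < `|val B 1 0 * expR t|.
    rewrite normrM (gtr0_norm y0); apply: lt_le_trans yt _.
    by rewrite mulrC; exact: ler_wpM2r (ltW y0) _ _ ec.
  have h2 : (val B 1 0 * expR t) ^+ 2 <= 2 * xi.
    apply: le_trans (_ : 2 * (expR m - 1) <= _); last by rewrite ler_pM2l.
    by apply: le_trans h; rewrite lerDr addr_ge0 ?sqr_ge0.
  move: h2; rewrite -real_normK ?num_real // expr2 => h2.
  by clear - h1 h2 xi0; nra.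
rewrite da /=; have h2 : (val B 0 0 - 1) ^+ 2 <= 2 * xi.
  apply: le_trans (_ : 2 * (expR m - 1) <= _); last by rewrite ler_pM2l.
  by apply: le_trans h; rewrite -addrA lerDl addr_ge0 ?sqr_ge0.
move: (val B 0 0) h2 => a h2; clear - h2 xi0; rewrite leNgt; apply/negP => a1.
by rewrite expr2 in h2; nra.
Qed.

Lemma liminf_Inj0_limits : liminf_Inj (\pi_(T1S G) w) = 0%E ->
  forall T, 1 <= T -> axis_limit L T.
Proof.
move=> h0; apply: (axis_limit_near_id (framed1 G w) (@framedM _ G w)).
  exact: framed_bottom_left_isolated.
move=> e e0; have e40 : 0 < e ^+ 2 / 4 by rewrite divr_gt0 // exprn_gt0.
(* A distance below m = ln (1 + e^2 / 4) bounds the sum of the squares of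
   a - 1, d - 1 and c y by e^2 / 2. *)
have m0 : 0 < ln (1 + e ^+ 2 / 4) by rewrite ln_gt0 // ltrDl.
have hm : (liminf_Inj (\pi_(T1S G) w) < (ln (1 + e ^+ 2 / 4))%:E)%E.
  by rewrite h0 lte_fin.
have [t t0 [B [LB c0 tr da]]] := liminf_Inj_normalized 0 hm.
have -> : 2 * (expR (ln (1 + e ^+ 2 / 4)) - 1) = e ^+ 2 / 2.
  by rewrite lnK ?posrE ?addr_gt0 //; field.
have e2 : e ^+ 2 / 2 < e ^+ 2.
  by rewrite ltr_pdivrMr // ltr_pMr ?ltr1n // exprn_gt0.
have lt_sqr (x : R) : x ^+ 2 < e ^+ 2 -> `|x| < e.
  rewrite -real_normK ?num_real // !ltNge; apply: contra => ex.
  by apply: lerXn2r; rewrite ?nnegrE //; exact: ltW.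
have y1 : 1 < expR t by rewrite -expR0 ltr_expR.
move=> h; exists B; split => //.
  apply: lt_sqr; apply: le_lt_trans e2.
  apply: le_trans h; apply: le_trans (_ : (val B 1 0 * expR t) ^+ 2 <= _).
    rewrite exprMn ler_peMr ?sqr_ge0 // expr_ge1 //; exact: ltW.
  by rewrite lerDr addr_ge0 ?sqr_ge0.
rewrite da -ltrBlDl /=; apply: le_lt_trans (ler_norm _) _.
apply: lt_sqr; apply: le_lt_trans e2.
by apply: le_trans h; rewrite -addrA lerDl addr_ge0 ?sqr_ge0.
Qed.

End ShortElements.

Theorem theorem1p1 (R : realType) (Gamma : fuchsian R)
  (no_elliptic : forall g : PSL2 R, Gamma g -> ~ elliptic g)
  (geom_infinite : ~ geometrically_finite Gamma)
  (u : T1S Gamma)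
  (u_nonwandering : non_wandering u)
  (u_almost_min : almost_minimizing u)
  (u_not_periodic : ~ horocycle_periodic u) :
  ((liminf_Inj u < +oo)%E ->
     exists t : nat -> R, t n @[n --> \oo] --> +oo /\
       forall n, closure (horocycle_orbit u) (geodesic_flowS (t n) u)) /\
  (liminf_Inj u = 0%E ->
     [set geodesic_flowS t u | t in [set t : R | 0 <= t]]
       `<=` closure (horocycle_orbit u)).
Proof.
move: u_almost_min u_not_periodic; rewrite -[u]reprK.
set w := repr u => amin nper; split => [hoo|h0].
  have lim n : exists t : R, n%:R <= t /\
      closure (horocycle_orbit (\pi_(T1S Gamma) w))
        (geodesic_flowS t (\pi_(T1S Gamma) w)).
    have [T nT limT] :=
      liminf_Inj_lty_limits no_elliptic amin nper hoo (expR n%:R).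
    have T0 : 0 < T by apply: lt_le_trans nT; exact: expR_gt0.
    exists (2 * ln T); split; last exact: axis_limit_closure.
    have nlnT : n%:R <= ln T by rewrite -ler_expR lnK.
    by apply: (le_trans nlnT); rewrite mulr_natl mulr2n lerDl (le_trans _ nlnT).
  have [t ht] := choice lim; exists t; split; last by move=> n; have [] := ht n.
  apply/cvgryPge => x; exists (Num.bound `|x|) => // n /= xn.
  apply: le_trans (_ : n%:R <= _); last by have [] := ht n.
  apply: le_trans (ler_norm _) _.
  apply: le_trans (ltW (archi_boundP (normr_ge0 x))) _.
  by rewrite ler_nat.
move=> _ [t t0 <-].
have -> : t = 2 * ln (expR (t / 2)) by rewrite expRK; field.
apply: axis_limit_closure; first exact: expR_gt0.
apply: (liminf_Inj0_limits no_elliptic amin nper h0).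
by rewrite -expR0 ler_expR divr_ge0.
Qed.
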